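(* Let $\psi : (\mathfrak h' \otimes A) \oplus \mathfrak h'' \to \mathbb C$ be a linear map, and suppose that the irreducible highest weight module $V(\psi)$ is an integrable $\mathfrak g_A$-module with finite-dimensional weight spaces with respect to $\mathfrak h$. Then there exists a radical ideal $J$ of $A$ (that is, $\sqrt J = J$) such that $\mathfrak g' \otimes J$ acts as zero on $V(\psi)$, so that $V(\psi)$ is a module for the Lie algebra $(\mathfrak g' \otimes A/J) \oplus \mathfrak h''$. In particular, for some positive integer $k$, $V(\psi)$ is a module for $\left(\bigoplus_{k\text{ times}} \mathfrak g'\right) \oplus \mathfrak h''$; that is, $J$ can be taken so that there is an algebra isomorphism $A/J \cong \mathbb C^k$, and the action of $\mathfrak g_A$ on $V(\psi)$ factors through the induced surjection $\mathfrak g_A \to (\mathfrak g' \otimes A/J) \oplus \mathfrak h'' \cong \left(\bigoplus_{k\text{ times}} \mathfrak g'\right) \oplus \mathfrak h''$.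
   Context: $\mathfrak g$ is a Kac-Moody Lie algebra over $\mathbb C$ with Cartan subalgebra $\mathfrak h$; $\mathfrak g' = [\mathfrak g, \mathfrak g]$; $\mathfrak h' = \mathfrak h \cap \mathfrak g'$; $\mathfrak h''$ is a complementary subspace of $\mathfrak h'$ in $\mathfrak h$, so $\mathfrak h = \mathfrak h' \oplus \mathfrak h''$. Write $\mathfrak g' = N^- \oplus \mathfrak h' \oplus N^+$ for the standard decomposition, where $N^{\pm}$ is the sum of the positive/negative root spaces. $A$ is a commutative, associative, unital, finitely generated (nonzero) $\mathbb C$-algebra. The current Kac-Moody algebra is $\mathfrak g_A = (\mathfrak g' \otimes A) \oplus \mathfrak h''$ with bracket $[X \otimes a, Y \otimes b] = [X,Y] \otimes ab$ and $[X \otimes a, h] = [X,h] \otimes a$ for $X, Y \in \mathfrak g'$, $h \in \mathfrak h''$, $a, b \in A$, and $\mathfrak h''$ abelian. $\mathfrak h$ is regarded as the subalgebra $(\mathfrak h' \otimes 1) \oplus \mathfrak h''$ of $\mathfrak g_A$. For an ideal $J$ of $A$, the Lie algebra $(\mathfrak g' \otimes A/J) \oplus \mathfrak h''$ is defined by the same formulas, and it is the quotient of $\mathfrak g_A$ by $\mathfrak g' \otimes J$. The Lie algebra $\left(\bigoplus_{k\text{ times}} \mathfrak g'\right) \oplus \mathfrak h''$ has $\mathfrak h''$ acting on each copy of $\mathfrak g'$ by the bracket of $\mathfrak g$. For a linear map $\psi : (\mathfrak h' \otimes A) \oplus \mathfrak h'' \to \mathbb C$, let $B = (N^+ \otimes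 A) \oplus (\mathfrak h' \otimes A) \oplus \mathfrak h''$, and let $\mathbb C(\psi)$ be the one-dimensional $B$-module on which $N^+ \otimes A$ acts by $0$ and $(\mathfrak h' \otimes A) \oplus \mathfrak h''$ acts by $\psi$. Put $M(\psi) = U(\mathfrak g_A) \otimes_{U(B)} \mathbb C(\psi)$. It is an $\mathfrak h$-weight module with a unique irreducible quotient, denoted $V(\psi)$. A $\mathfrak g_A$-module $V$ is integrable if (1) $V = \bigoplus_{\lambda \in \mathfrak h^*} V_\lambda$, where $V_\lambda = \{v \in V : hv = \lambda(h) v \text{ for all } h \in \mathfrak h\}$ are the weight spaces; and (2) for every real root $\alpha$ of $\mathfrak g$, every $a \in A$ and every $v \in V$ there exists a positive integer $k$ such that $(X_\alpha \otimes a)^k v = 0$, where $X_\alpha$ is a root vector for $\alpha$. The radical of an ideal $I$ is $\sqrt I = \{a \in A : a^n \in I \text{ for some positive integer } n\}$. *)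

(* Defs.v *)
From HB Require Import structures.
From mathcomp Require Import all_boot all_order all_algebra reals complex boolp.
Set Implicit Arguments.
Unset Strict Implicit.
Unset Printing Implicit Defensive.
Import GRing.Theory.
Local Open Scope ring_scope.
Local Open Scope quotient_scope.


Section SubspaceTypes.
Variables (K : fieldType) (V : lmodType K).

Record sub_of (S : submodClosed V) : Type :=
  SubOf { sub_val : V; sub_valP : sub_val \in S }.

Section Inst.
Variable S : submodClosed V.
HB.instance Definition _ := [isSub of sub_of S for @sub_val S].
HB.instance Definition _ := [Choice of sub_of S by <:].
HB.instance Definition _ := [SubChoice_isSubLmodule of sub_of S by <:].
End Inst.

Definition span_of (P : V -> Prop) : {pred V} := [pred x |
  `[< forall S : submodClosed V, (forall y, P y -> y \in S) -> x \in S >]].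

Lemma span_ofP (P : V -> Prop) x : reflect
  (forall S : submodClosed V, (forall y, P y -> y \in S) -> x \in S)
  (x \in span_of P).
Proof. exact: asboolP. Qed.

Lemma span_of_submod P : submod_closed (span_of P).
Proof.
split; first by apply/span_ofP => S _; rewrite rpred0.
move=> c x y /span_ofP Hx /span_ofP Hy; apply/span_ofP => S HS.
by rewrite rpredD ?rpredZ ?Hx ?Hy.
Qed.
HB.instance Definition _ P := GRing.isSubmodClosed.Build K V (span_of P)
  (span_of_submod P).

Lemma mem_span P x : P x -> x \in span_of P.
Proof. by move=> Px; apply/span_ofP => S; apply. Qed.

Lemma span_ind (P Q : V -> Prop) : Q 0 ->
  (forall c x y, Q x -> Q y -> Q (c *: x + y)) -> (forall x, P x -> Q x) ->
  forall x, x \in span_of P -> Q x.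
Proof.
move=> Q0 QD PQ x /span_ofP Hx.
pose S : {pred V} := [pred y | `[< Q y >]].
have Sc : submod_closed S.
  by split=> [|c y z /asboolP Qy /asboolP Qz]; apply/asboolP; auto.
pose SS := HB.pack_for (submodClosed V) S (GRing.isSubmodClosed.Build K V S Sc).
by apply/asboolP; apply: (Hx SS) => y Py; apply/asboolP/PQ.
Qed.

End SubspaceTypes.

Section Quotient.
Variables (K : fieldType) (V : lmodType K) (S : submodClosed V).

Definition qequiv (x y : V) := x - y \in S.

Lemma qequiv_is_equiv : equiv_class_of qequiv.
Proof.
split=> [x|x y|y x z]; rewrite /qequiv ?subrr ?rpred0 //.
  by apply/idP/idP => H; rewrite -opprB -scaleN1r rpredZ.
by move=> *; rewrite -[x](addrNK y) -addrA rpredD.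
Qed.
Canonical qequiv_equiv := EquivRelPack qequiv_is_equiv.
Canonical qequiv_encModRel := defaultEncModRel qequiv.

Definition quotv := {eq_quot qequiv}.
HB.instance Definition _ : EqQuotient V qequiv quotv := EqQuotient.on quotv.
HB.instance Definition _ := Choice.on quotv.

Definition qpi (x : V) : quotv := \pi_quotv x.

Lemma qpiP x y : reflect (qpi x = qpi y) (x - y \in S).
Proof.
by apply: (iffP idP) => [H|/eqmodP //]; apply/eqmodP.
Qed.

Lemma qpi_repr (q : quotv) : qpi (repr q) = q.
Proof. exact: reprK. Qed.

Lemma repr_qpi x : repr (qpi x) - x \in S.
Proof. by apply/qpiP; rewrite qpi_repr. Qed.

Definition qadd (p q : quotv) := qpi (repr p + repr q).
Definition qopp (p : quotv) := qpi (- repr p).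
Definition qscale (c : K) (p : quotv) := qpi (c *: repr p).

Lemma qpiD x y : qpi (x + y) = qadd (qpi x) (qpi y).
Proof.
apply/qpiP; rewrite -[_ - _]opprB -scaleN1r rpredZ // opprD addrACA.
by rewrite rpredD ?repr_qpi.
Qed.
Lemma qpiN x : qpi (- x) = qopp (qpi x).
Proof. by apply/qpiP; rewrite opprK addrC repr_qpi. Qed.
Lemma qpiZ c x : qpi (c *: x) = qscale c (qpi x).
Proof.
by apply/esym/qpiP; rewrite -scalerBr rpredZ ?repr_qpi.
Qed.

Lemma qaddA : associative qadd.
Proof.
move=> x y z; rewrite -[x]qpi_repr -[y]qpi_repr -[z]qpi_repr.
by rewrite -!qpiD addrA.
Qed.
Lemma qaddC : commutative qadd.
Proof. by move=> x y; rewrite /qadd addrC. Qed.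
Lemma qadd0 : left_id (qpi 0) qadd.
Proof. by move=> x; rewrite -[x]qpi_repr -qpiD add0r. Qed.
Lemma qaddN : left_inverse (qpi 0) qopp qadd.
Proof. by move=> x; rewrite -[x]qpi_repr -qpiN -qpiD addNr. Qed.
HB.instance Definition _ := GRing.isZmodule.Build quotv qaddA qaddC qadd0 qaddN.

Lemma qpi_add x y : qpi (x + y) = qpi x + qpi y.
Proof. exact: qpiD. Qed.

Lemma qscaleA a b v : qscale a (qscale b v) = qscale (a * b) v.
Proof. by rewrite -[v]qpi_repr -!qpiZ scalerA. Qed.
Lemma qscale1 : left_id 1 qscale.
Proof. by move=> v; rewrite -[v]qpi_repr -!qpiZ scale1r. Qed.
Lemma qscaleDr : right_distributive qscale +%R.
Proof.
move=> a u v; rewrite -[u]qpi_repr -[v]qpi_repr.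
by rewrite -qpi_add -!qpiZ -qpi_add scalerDr.
Qed.
Lemma qscaleDl v : {morph qscale^~ v : a b / a + b}.
Proof.
by move=> a b; rewrite /= -[v]qpi_repr -!qpiZ -qpi_add scalerDl.
Qed.
HB.instance Definition _ := GRing.Zmodule_isLmodule.Build K quotv
  qscaleA qscale1 qscaleDr qscaleDl.

Lemma qpi_linear : linear qpi.
Proof. by move=> c x y; rewrite qpiD qpiZ. Qed.
HB.instance Definition _ := GRing.isLinear.Build K V quotv *:%R qpi qpi_linear.

End Quotient.


Section Presentations.
Variables (K : fieldType) (O X : Type).

(* O indexes the bilinear operations: O = void presents a vector space,
   O = unit a vector space with a single product. *)
Inductive term : Type :=
| Gen of X
| Zero
| Add of term & term
| Scale of K & term
| Op of O & term & term.

Inductive pcong (R : term -> term -> Prop) : term -> term -> Prop :=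
| pc_rel t u : R t u -> pcong R t u
| pc_refl t : pcong R t t
| pc_sym t u : pcong R t u -> pcong R u t
| pc_trans t u w : pcong R t u -> pcong R u w -> pcong R t w
| pc_Add t t' u u' : pcong R t t' -> pcong R u u' ->
    pcong R (Add t u) (Add t' u')
| pc_Scale c t t' : pcong R t t' -> pcong R (Scale c t) (Scale c t')
| pc_Op o t t' u u' : pcong R t t' -> pcong R u u' ->
    pcong R (Op o t u) (Op o t' u')
| pc_addA t u w : pcong R (Add t (Add u w)) (Add (Add t u) w)
| pc_addC t u : pcong R (Add t u) (Add u t)
| pc_add0 t : pcong R (Add Zero t) t
| pc_addN t : pcong R (Add (Scale (-1) t) t) Zero
| pc_scaleA a b t : pcong R (Scale a (Scale b t)) (Scale (a * b) t)
| pc_scale1 t : pcong R (Scale 1 t) t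
| pc_scaleDr a t u : pcong R (Scale a (Add t u)) (Add (Scale a t) (Scale a u))
| pc_scaleDl a b t : pcong R (Scale (a + b) t) (Add (Scale a t) (Scale b t))
| pc_opDl o t u w : pcong R (Op o (Add t u) w) (Add (Op o t w) (Op o u w))
| pc_opDr o t u w : pcong R (Op o w (Add t u)) (Add (Op o w t) (Op o w u))
| pc_opZl o c t w : pcong R (Op o (Scale c t) w) (Scale c (Op o t w))
| pc_opZr o c t w : pcong R (Op o w (Scale c t)) (Scale c (Op o w t)).

Section Pres.
Variable R : term -> term -> Prop.

Definition pcongb (t u : {classic term}) : bool := `[< pcong R t u >].

Lemma pcongb_is_equiv : equiv_class_of pcongb.
Proof.
split=> [x|x y|y x z]; first by apply/asboolP; apply: pc_refl.
  by apply/asboolP/asboolP; apply: pc_sym.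
by move=> /asboolP xy /asboolP yz; apply/asboolP; apply: pc_trans yz.
Qed.
Canonical pcongb_equiv := EquivRelPack pcongb_is_equiv.
Canonical pcongb_encModRel := defaultEncModRel pcongb.

Definition pres := {eq_quot pcongb}.
HB.instance Definition _ : EqQuotient {classic term} pcongb pres :=
  EqQuotient.on pres.
HB.instance Definition _ := Choice.on pres.

Definition ppi (t : term) : pres := \pi_pres (t : {classic term}).
Definition prepr (p : pres) : term := repr p.

Lemma ppiP t u : ppi t = ppi u <-> pcong R t u.
Proof.
split=> [H|H]; last by apply/eqmodP/asboolP.
by have /eqmodP/asboolP : (t : {classic term}) = u %[mod pres] := H.
Qed.

Lemma preprK p : ppi (prepr p) = p.
Proof. exact: reprK. Qed.

Lemma prepr_ppi t : pcong R (prepr (ppi t)) t.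
Proof. by apply/ppiP; rewrite preprK. Qed.

Definition pgen x := ppi (Gen x).
Definition padd p q := ppi (Add (prepr p) (prepr q)).
Definition pscale c p := ppi (Scale c (prepr p)).
Definition pop o p q := ppi (Op o (prepr p) (prepr q)).

Lemma ppiD t u : ppi (Add t u) = padd (ppi t) (ppi u).
Proof. by apply/ppiP/pc_Add; apply/pc_sym/prepr_ppi. Qed.
Lemma ppiZ c t : ppi (Scale c t) = pscale c (ppi t).
Proof. by apply/ppiP/pc_Scale; apply/pc_sym/prepr_ppi. Qed.
Lemma ppiM o t u : ppi (Op o t u) = pop o (ppi t) (ppi u).
Proof. by apply/ppiP/pc_Op; apply/pc_sym/prepr_ppi. Qed.

Lemma paddA : associative padd.
Proof.
move=> x y z; rewrite -[x]preprK -[y]preprK -[z]preprK.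
by rewrite -!ppiD; apply/ppiP; constructor.
Qed.
Lemma paddC : commutative padd.
Proof.
move=> x y; rewrite -[x]preprK -[y]preprK.
by rewrite -!ppiD; apply/ppiP; constructor.
Qed.
Lemma padd0 : left_id (ppi Zero) padd.
Proof.
by move=> x; rewrite -[x]preprK -ppiD; apply/ppiP; constructor.
Qed.
Lemma paddN : left_inverse (ppi Zero) (pscale (-1)) padd.
Proof.
by move=> x; rewrite -[x]preprK -ppiZ -ppiD; apply/ppiP; constructor.
Qed.
HB.instance Definition _ := GRing.isZmodule.Build pres paddA paddC padd0 paddN.

Lemma ppi_add t u : ppi (Add t u) = ppi t + ppi u.
Proof. exact: ppiD. Qed.

Lemma pscaleA a b v : pscale a (pscale b v) = pscale (a * b) v.
Proof. by rewrite -[v]preprK -!ppiZ; apply/ppiP; constructor. Qed.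
Lemma pscale1 : left_id 1 pscale.
Proof. by move=> v; rewrite -[v]preprK -!ppiZ; apply/ppiP; constructor. Qed.
Lemma pscaleDr : right_distributive pscale +%R.
Proof.
move=> a u v; rewrite -[u]preprK -[v]preprK -ppi_add -!ppiZ -ppi_add.
by apply/ppiP; constructor.
Qed.
Lemma pscaleDl v : {morph pscale^~ v : a b / a + b}.
Proof.
move=> a b /=; rewrite -[v]preprK -!ppiZ -ppi_add.
by apply/ppiP; constructor.
Qed.
HB.instance Definition _ := GRing.Zmodule_isLmodule.Build K pres
  pscaleA pscale1 pscaleDr pscaleDl.

Lemma ppi0 : ppi Zero = 0. Proof. by []. Qed.
Lemma ppi_scale c t : ppi (Scale c t) = c *: ppi t.
Proof. exact: ppiZ. Qed.

Lemma pop_linl o q : linear (pop o ^~ q).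
Proof.
move=> c x y; rewrite -[x]preprK -[y]preprK -[q]preprK.
rewrite -ppi_scale -ppi_add -!ppiM -ppi_scale -ppi_add; apply/ppiP.
by apply: pc_trans (pc_opDl _ _ _ _ _) _; apply: pc_Add; constructor.
Qed.
Lemma pop_linr o q : linear (pop o q).
Proof.
move=> c x y; rewrite -[x]preprK -[y]preprK -[q]preprK.
rewrite -ppi_scale -ppi_add -!ppiM -ppi_scale -ppi_add; apply/ppiP.
by apply: pc_trans (pc_opDr _ _ _ _ _) _; apply: pc_Add; constructor.
Qed.

Lemma pres_ind (P : pres -> Prop) :
  (forall x, P (pgen x)) -> P 0 -> (forall p q, P p -> P q -> P (p + q)) ->
  (forall c p, P p -> P (c *: p)) ->
  (forall o p q, P p -> P q -> P (pop o p q)) -> forall p, P p.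
Proof.
move=> Hg H0 HD HZ HM p; rewrite -[p]preprK.
elim: (prepr p) => [x||t Ht u Hu|c t Ht|o t Ht u Hu].
- exact: Hg.
- by rewrite ppi0.
- by rewrite ppi_add; apply: HD.
- by rewrite ppi_scale; apply: HZ.
- by rewrite ppiM; apply: HM.
Qed.

End Pres.

Section Lift.
Variables (W : lmodType K) (wop : O -> W -> W -> W) (f : X -> W).

Fixpoint eval (t : term) : W :=
  match t with
  | Gen x => f x
  | Zero => 0
  | Add t u => eval t + eval u
  | Scale c t => c *: eval t
  | Op o t u => wop o (eval t) (eval u)
  end.

Hypothesis wopl : forall o w, linear (wop o ^~ w).
Hypothesis wopr : forall o w, linear (wop o w).
Variable R : term -> term -> Prop.
Hypothesis fR : forall t u, R t u -> eval t = eval u.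

Lemma eval_pcong t u : pcong R t u -> eval t = eval u.
Proof.
elim=> //= {t u}; try by congruence.
- by move=> t u w; rewrite addrA.
- by move=> t u; rewrite addrC.
- by move=> t; rewrite add0r.
- by move=> t; rewrite scaleN1r addNr.
- by move=> a b t; rewrite scalerA.
- by move=> t; rewrite scale1r.
- by move=> a t u; rewrite scalerDr.
- by move=> a b t; rewrite scalerDl.
- by move=> o t u w; have := wopl o (eval w) 1 (eval t) (eval u); rewrite /= !scale1r.
- by move=> o t u w; have := wopr o (eval w) 1 (eval t) (eval u); rewrite /= !scale1r.
- move=> o c t w; have := wopl o (eval w) c (eval t) 0; rewrite /= !addr0 => ->.
  have := wopl o (eval w) (-1) 0 0; rewrite /= scaleN1r oppr0 addr0 scaleN1r addNr.
  by move=> ->; rewrite addr0.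
- move=> o c t w; have := wopr o (eval w) c (eval t) 0; rewrite /= !addr0 => ->.
  have := wopr o (eval w) (-1) 0 0; rewrite /= scaleN1r oppr0 addr0 scaleN1r addNr.
  by move=> ->; rewrite addr0.
Qed.

End Lift.

Definition plift (W : lmodType K) (wop : O -> W -> W -> W) (f : X -> W)
  (R : term -> term -> Prop) (p : pres R) : W := eval wop f (prepr p).

End Presentations.
Arguments Zero {K O X}.
Arguments Gen {K O X} _.
Arguments pgen {K O X} R _.
Arguments ppi {K O X} R _.
Arguments plift {K O X W} wop f {R} p.

Section LiftTheory.
Variables (K : fieldType) (O X : Type) (W : lmodType K).
Variables (wop : O -> W -> W -> W) (f : X -> W).
Hypothesis wopl : forall o w, linear (wop o ^~ w).
Hypothesis wopr : forall o w, linear (wop o w).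
Variable R : term K O X -> term K O X -> Prop.
Hypothesis fR : forall t u, R t u -> eval wop f t = eval wop f u.

Lemma plift_ppi t : plift wop f (ppi R t) = eval wop f t.
Proof. by apply: (eval_pcong wopl wopr fR); apply: prepr_ppi. Qed.
Lemma plift_gen x : plift wop f (pgen R x) = f x.
Proof. by rewrite plift_ppi. Qed.
Lemma plift_linear : linear (plift wop f : pres R -> W).
Proof.
move=> c x y; rewrite -[x]preprK -[y]preprK -ppi_scale -ppi_add.
by rewrite !plift_ppi.
Qed.
Lemma plift_op o p q : plift wop f (pop o p q : pres R) =
  wop o (plift wop f p) (plift wop f q).
Proof.
by rewrite -[p]preprK -[q]preprK -ppiM !plift_ppi.
Qed.
End LiftTheory.


HB.mixin Record isLie (K : fieldType) L of GRing.Lmodule K L := {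
  bracket : L -> L -> L;
  bracket_linl : forall y, linear (bracket ^~ y);
  bracket_linr : forall x, linear (bracket x);
  bracket_alt : forall x, bracket x x = 0;
  bracket_jacobi : forall x y z,
    bracket x (bracket y z) + bracket y (bracket z x)
      + bracket z (bracket x y) = 0
}.
#[short(type="lieAlgType")]
HB.structure Definition LieAlg (K : fieldType) :=
  {L of isLie K L & GRing.Lmodule K L}.

Section BilinearTheory.
Variables (K : fieldType) (U V W : lmodType K) (b : U -> V -> W).
Hypothesis bl : forall y, linear (b ^~ y).
Hypothesis br : forall x, linear (b x).
Lemma bilDl x x' y : b (x + x') y = b x y + b x' y.
Proof. by have := bl y 1 x x'; rewrite /= !scale1r. Qed.
Lemma bilDr x y y' : b x (y + y') = b x y + b x y'.
Proof. by have := br x 1 y y'; rewrite /= !scale1r. Qed.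
Lemma bil0l y : b 0 y = 0.
Proof. by apply: (addrI (b 0 y)); rewrite -bilDl !addr0. Qed.
Lemma bil0r x : b x 0 = 0.
Proof. by apply: (addrI (b x 0)); rewrite -bilDr !addr0. Qed.
Lemma bilZl c x y : b (c *: x) y = c *: b x y.
Proof. by have := bl y c x 0; rewrite /= !addr0 bil0l addr0. Qed.
Lemma bilZr c x y : b x (c *: y) = c *: b x y.
Proof. by have := br x c y 0; rewrite /= !addr0 bil0r addr0. Qed.
Lemma bilNl x y : b (- x) y = - b x y.
Proof. by rewrite -scaleN1r bilZl scaleN1r. Qed.
Lemma bilNr x y : b x (- y) = - b x y.
Proof. by rewrite -scaleN1r bilZr scaleN1r. Qed.
End BilinearTheory.

Section LieTheory.
Variables (K : fieldType) (L : lieAlgType K).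
Implicit Types x y z : L.
Definition bracketDl := bilDl (@bracket_linl K L).
Definition bracketDr := bilDr (@bracket_linr K L).
Definition bracketZl := bilZl (@bracket_linl K L).
Definition bracketZr := bilZr (@bracket_linr K L).
Definition bracketNl := bilNl (@bracket_linl K L).
Definition bracketNr := bilNr (@bracket_linr K L).
Definition bracket0l := bil0l (@bracket_linl K L).
Definition bracket0r := bil0r (@bracket_linr K L).
Lemma bracketC x y : bracket x y = - bracket y x.
Proof.
apply/eqP; rewrite -addr_eq0; apply/eqP.
by have := bracket_alt (x + y);
  rewrite bracketDl !bracketDr !bracket_alt add0r addr0.
Qed.
Lemma bracket_leibniz x y z :
  bracket x (bracket y z) = bracket (bracket x y) z + bracket y (bracket x z).
Proof.
apply/eqP; rewrite -subr_eq0; have := bracket_jacobi x y z.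
rewrite (bracketC z x) (bracketC z (bracket x y)) bracketNr => H.
by rewrite opprD addrA addrAC H.
Qed.
End LieTheory.

Definition lie_hom (K : fieldType) (L M : lieAlgType K) (f : L -> M) : Prop :=
  linear f /\ forall x y, f (bracket x y) = bracket (f x) (f y).

Definition lie_iso (K : fieldType) (L M : lieAlgType K) (f : L -> M) : Prop :=
  lie_hom f /\ bijective f.

HB.mixin Record isLieClosed (K : fieldType) (L : lieAlgType K) (S : {pred L}) :=
  { lieclosed : forall x y, x \in S -> y \in S -> bracket x y \in S }.
#[short(type="lieClosed")]
HB.structure Definition LieClosed (K : fieldType) (L : lieAlgType K) :=
  {S of isLieClosed K L S & GRing.AddClosed L S & GRing.isScaleClosed K L S}.

HB.mixin Record isLieIdeal (K : fieldType) (L : lieAlgType K) (S : {pred L}) :=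
  { lieideal : forall x y, y \in S -> bracket x y \in S }.
#[short(type="lieIdeal")]
HB.structure Definition LieIdeal (K : fieldType) (L : lieAlgType K) :=
  {S of isLieIdeal K L S & GRing.AddClosed L S & GRing.isScaleClosed K L S}.

Section SubLie.
Variables (K : fieldType) (L : lieAlgType K) (S : lieClosed L).
Definition sublie := sub_of S.
HB.instance Definition _ := SubType.on sublie.
HB.instance Definition _ := GRing.Lmodule.on sublie.

Definition sub_bracket (x y : sublie) : sublie :=
  SubOf (lieclosed _ _ (sub_valP x) (sub_valP y)).
Lemma sub_val_linear : linear (@sub_val K L S).
Proof. by []. Qed.

Lemma sub_bracket_linl y : linear (sub_bracket ^~ y).
Proof.
move=> c u v; apply: val_inj; rewrite [LHS]/= [RHS]/=.
by rewrite bracketDl bracketZl.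
Qed.
Lemma sub_bracket_linr x : linear (sub_bracket x).
Proof.
move=> c u v; apply: val_inj; rewrite [LHS]/= [RHS]/=.
by rewrite bracketDr bracketZr.
Qed.
Lemma sub_bracket_alt x : sub_bracket x x = 0.
Proof. by apply: val_inj; rewrite /= bracket_alt. Qed.
Lemma sub_bracket_jacobi x y z :
  sub_bracket x (sub_bracket y z) + sub_bracket y (sub_bracket z x)
    + sub_bracket z (sub_bracket x y) = 0.
Proof. by apply: val_inj; rewrite /= bracket_jacobi. Qed.
HB.instance Definition _ := isLie.Build K sublie sub_bracket_linl
  sub_bracket_linr sub_bracket_alt sub_bracket_jacobi.
End SubLie.

Section QuotLie.
Variables (K : fieldType) (L : lieAlgType K) (I : lieIdeal L).
Definition quotlie := quotv I.
HB.instance Definition _ := GRing.Lmodule.on quotlie.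

Definition qlpi (x : L) : quotlie := qpi I x.
Definition quot_bracket (p q : quotlie) : quotlie :=
  qlpi (bracket (repr p) (repr q)).

Lemma qlpi_repr (q : quotlie) : qlpi (repr q) = q.
Proof. exact: qpi_repr. Qed.
Lemma qlpiD x y : qlpi (x + y) = qlpi x + qlpi y.
Proof. exact: qpi_add. Qed.
Lemma qlpiZ c x : qlpi (c *: x) = c *: qlpi x.
Proof. exact: qpiZ. Qed.

Lemma qlpi_bracket x y : qlpi (bracket x y) = quot_bracket (qlpi x) (qlpi y).
Proof.
apply/esym/qpiP; set x' := repr _; set y' := repr _.
have Hx : x' - x \in I by apply: repr_qpi.
have Hy : y' - y \in I by apply: repr_qpi.
have -> : bracket x' y' - bracket x y = bracket x' (y' - y) + bracket (x' - x) y.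
  by rewrite bracketDr bracketDl bracketNr bracketNl addrA addrNK.
apply: rpredD; first exact: lieideal.
by rewrite bracketC -scaleN1r rpredZ // lieideal.
Qed.

Lemma quot_bracket_linl y : linear (quot_bracket ^~ y).
Proof.
move=> c u v; rewrite -[y]qlpi_repr -[u]qlpi_repr -[v]qlpi_repr.
rewrite -qlpiZ -qlpiD -!qlpi_bracket -qlpiZ -qlpiD.
by rewrite bracketDl bracketZl.
Qed.
Lemma quot_bracket_linr x : linear (quot_bracket x).
Proof.
move=> c u v; rewrite -[x]qlpi_repr -[u]qlpi_repr -[v]qlpi_repr.
rewrite -qlpiZ -qlpiD -!qlpi_bracket -qlpiZ -qlpiD.
by rewrite bracketDr bracketZr.
Qed.
Lemma quot_bracket_alt x : quot_bracket x x = 0.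
Proof. by rewrite -[x]qlpi_repr -qlpi_bracket bracket_alt. Qed.
Lemma quot_bracket_jacobi x y z :
  quot_bracket x (quot_bracket y z) + quot_bracket y (quot_bracket z x)
    + quot_bracket z (quot_bracket x y) = 0.
Proof.
rewrite -[x]qlpi_repr -[y]qlpi_repr -[z]qlpi_repr -!qlpi_bracket -!qlpiD.
by rewrite bracket_jacobi.
Qed.
HB.instance Definition _ := isLie.Build K quotlie quot_bracket_linl
  quot_bracket_linr quot_bracket_alt quot_bracket_jacobi.
Lemma qlpi_lie x y : qlpi (bracket x y) = bracket (qlpi x) (qlpi y).
Proof. exact: qlpi_bracket. Qed.
End QuotLie.

Lemma span_bracket (K : fieldType) (L : lieAlgType K) (P : L -> Prop) :
  (forall x y, P x -> P y -> bracket x y \in span_of P) ->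
  forall x y, x \in span_of P -> y \in span_of P -> bracket x y \in span_of P.
Proof.
move=> H x y Hx Hy; move: x Hx; apply: span_ind => [|c x x' IH IH'|x Px].
- by rewrite bracket0l rpred0.
- by rewrite bracketDl bracketZl rpredD ?rpredZ.
move: y Hy; apply: span_ind => [|c y y' IH IH'|y Py].
- by rewrite bracket0r rpred0.
- by rewrite bracketDr bracketZr rpredD ?rpredZ.
exact: H.
Qed.

Section Derived.
Variables (K : fieldType) (L : lieAlgType K).

Definition derived : {pred L} := span_of (fun z => exists x y : L, z = bracket x y).
HB.instance Definition _ := GRing.SubmodClosed.on derived.
Lemma derived_bracket x y : bracket x y \in derived.
Proof. by apply: mem_span; exists x, y. Qed.
HB.instance Definition _ := isLieClosed.Build K L derived
  (fun x y _ _ => derived_bracket x y).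
End Derived.
Arguments derived {K} L _.

Section LiePresentation.
Variables (K : fieldType) (X : Type).
Local Notation tm := (term K unit X).
Variable R : tm -> tm -> Prop.

Inductive lie_rel : tm -> tm -> Prop :=
| lr_rel t u : R t u -> lie_rel t u
| lr_alt t : lie_rel (Op tt t t) Zero
| lr_jacobi t u w : lie_rel (Add (Add (Op tt t (Op tt u w))
    (Op tt u (Op tt w t))) (Op tt w (Op tt t u))) Zero.

Definition lie_pres := pres lie_rel.
HB.instance Definition _ := GRing.Lmodule.on lie_pres.
Definition lie_gen (x : X) : lie_pres := pgen lie_rel x.

Lemma lp_alt (x : lie_pres) : pop tt x x = 0.
Proof.
by rewrite -[x]preprK -ppiM -ppi0; apply/ppiP/pc_rel; constructor.
Qed.
Lemma lp_jacobi (x y z : lie_pres) :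
  pop tt x (pop tt y z) + pop tt y (pop tt z x) + pop tt z (pop tt x y) = 0.
Proof.
rewrite -[x]preprK -[y]preprK -[z]preprK -!ppiM -!ppi_add -ppi0.
by apply/ppiP/pc_rel; constructor.
Qed.
HB.instance Definition _ := isLie.Build K lie_pres
  (@pop_linl K unit X lie_rel tt) (@pop_linr K unit X lie_rel tt)
  lp_alt lp_jacobi.
Lemma lie_pres_bracket t u :
  bracket (ppi lie_rel t : lie_pres) (ppi lie_rel u) = ppi lie_rel (Op tt t u).
Proof. exact/esym/ppiM. Qed.
End LiePresentation.
Arguments lie_gen {K X} R x.

(* The action of an abelian Lie algebra H on a Lie algebra L by commuting
   derivations, and the semidirect product of L by H. *)
Section Semidirect.
Variables (K : fieldType) (H : lmodType K) (L : lieAlgType K).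

Record der_action := DerAction {
  der :> H -> L -> L;
  der_linl : forall x, linear (der ^~ x);
  der_linr : forall h, linear (der h);
  der_leibniz : forall h x y,
    der h (bracket x y) = bracket (der h x) y + bracket x (der h y);
  der_comm : forall h k x, der h (der k x) = der k (der h x)
}.

Definition semidir (_ : der_action) : Type := (L * H)%type.

Variable d : der_action.
HB.instance Definition _ := GRing.Lmodule.on (semidir d).

Definition semidir_bracket (p q : semidir d) : semidir d :=
  (bracket p.1 q.1 + d p.2 q.1 - d q.2 p.1, 0).

Lemma semidir_linl q : linear (semidir_bracket ^~ q).
Proof.
move=> c p p'; rewrite /semidir_bracket; congr pair => /=; last first.
  by rewrite scaler0 addr0.
rewrite bracketDl bracketZl (bilDl (der_linl d)) (bilZl (der_linl d)).
rewrite (bilDr (der_linr d)) (bilZr (der_linr d)).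
rewrite !scalerDr scalerN opprD [RHS]addrACA; congr (_ + _).
by rewrite [LHS]addrACA.
Qed.
Lemma semidir_alt p : semidir_bracket p p = 0.
Proof. by rewrite /semidir_bracket bracket_alt add0r subrr. Qed.
Lemma semidir_anti p q : semidir_bracket p q = - semidir_bracket q p.
Proof.
congr pair; rewrite /= ?oppr0 //.
by rewrite bracketC !opprD opprK addrAC.
Qed.
Lemma semidir_linr p : linear (semidir_bracket p).
Proof.
move=> c q q'; rewrite 3!(semidir_anti p) semidir_linl opprD.
by rewrite scalerN.
Qed.

Lemma semidir_nested x h y k z l :
  (semidir_bracket (x, h) (semidir_bracket (y, k) (z, l))).1 =
  bracket x (bracket y z)
  + ((bracket x (d k z) + bracket y (d h z))
     - (bracket x (d l y) + bracket z (d h y)))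
  + (d h (d k z) - d h (d l y)).
Proof.
rewrite /= (bil0l (der_linl d)) subr0.
have dD h0 := bilDr (der_linr d) h0.
have dN h0 := bilNr (der_linr d) h0.
rewrite !(dD, dN, bracketDr, bracketNr, der_leibniz).
rewrite (bracketC (d h y) z) !opprD !addrA.
by rewrite [LHS](ACl (1*2*5*3*4*6*7)).
Qed.

Lemma semidir_jacobi p q r :
  semidir_bracket p (semidir_bracket q r) +
  semidir_bracket q (semidir_bracket r p) +
  semidir_bracket r (semidir_bracket p q) = 0.
Proof.
case: p q r => [x h] [y k] [z l].
have cancel3 (V : zmodType) (a b c : V) : a - b + (c - a) + (b - c) = 0.
  by rewrite [a - b + _]addrC !addrA !subrK subrr.
have E (V1 V2 : zmodType) (u : V1 * V2) : u.1 = 0 -> u.2 = 0 -> u = 0.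
  by case: u => u1 u2 /= -> ->.
apply: E; last by rewrite /= !addr0.
rewrite [LHS](_ : _ =
  (semidir_bracket (x, h) (semidir_bracket (y, k) (z, l))).1 +
  (semidir_bracket (y, k) (semidir_bracket (z, l) (x, h))).1 +
  (semidir_bracket (z, l) (semidir_bracket (x, h) (y, k))).1) //.
rewrite !semidir_nested (der_comm d k h z) (der_comm d l h y) (der_comm d l k x).
rewrite (addrC (bracket y (d h z)) (bracket x (d k z))).
rewrite (addrC (bracket z (d h y)) (bracket x (d l y))).
rewrite (addrC (bracket z (d k x)) (bracket y (d l x))).
rewrite [X in X + _]addrACA [LHS]addrACA.
rewrite [X in _ + X = _](_ : _ = 0) ?addr0; last first.
  exact: cancel3.
rewrite [X in X + _]addrACA [LHS]addrACA cancel3 addr0.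
exact: bracket_jacobi.
Qed.
HB.instance Definition _ := isLie.Build K (semidir d) semidir_linl semidir_linr
  semidir_alt semidir_jacobi.
Lemma semidir_bracketE x h y k :
  bracket ((x, h) : semidir d) (y, k) = (bracket x y + d h y - d k x, 0).
Proof. by []. Qed.
End Semidirect.

Section Tensor.
Variables (K : fieldType) (V W : lmodType K).
Local Notation tm := (term K void (V * W)).

Inductive tens_rel : tm -> tm -> Prop :=
| tr_linl c v v' w : tens_rel (Gen (c *: v + v', w))
    (Add (Scale c (Gen (v, w))) (Gen (v', w)))
| tr_linr c v w w' : tens_rel (Gen (v, c *: w + w'))
    (Add (Scale c (Gen (v, w))) (Gen (v, w'))).

Definition tens := pres tens_rel.
HB.instance Definition _ := GRing.Lmodule.on tens.
Definition tpure (v : V) (w : W) : tens := pgen tens_rel (v, w).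

Lemma tpure_linl w : linear (tpure ^~ w).
Proof.
move=> c u v; rewrite /tpure /pgen -ppi_scale -ppi_add.
by apply/ppiP/pc_rel; constructor.
Qed.
Lemma tpure_linr v : linear (tpure v).
Proof.
move=> c u w; rewrite /tpure /pgen -ppi_scale -ppi_add.
by apply/ppiP/pc_rel; constructor.
Qed.

Lemma tens_ind (P : tens -> Prop) :
  (forall v w, P (tpure v w)) -> P 0 -> (forall s t, P s -> P t -> P (s + t)) ->
  (forall c t, P t -> P (c *: t)) -> forall t, P t.
Proof. by move=> Hg H0 HD HZ; apply: pres_ind => //; case=> *; exact: Hg. Qed.

Definition no_op (T : Type) (o : void) : T -> T -> T := match o with end.

Variable T : lmodType K.
Definition tlift (f : V -> W -> T) (t : tens) : T :=
  plift (@no_op T) (fun p => f p.1 p.2) t.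

Variable f : V -> W -> T.
Hypothesis fl : forall w, linear (f ^~ w).
Hypothesis fr : forall v, linear (f v).

Lemma tlift_rel t u : tens_rel t u ->
  eval (@no_op T) (fun p => f p.1 p.2) t = eval (@no_op T) (fun p => f p.1 p.2) u.
Proof. by case=> [c v v' w|c v w w'] /=; [exact: fl|exact: fr]. Qed.
Lemma tlift_pure v w : tlift f (tpure v w) = f v w.
Proof. by apply: plift_gen; [case|case|exact: tlift_rel]. Qed.
Lemma tlift_linear : linear (tlift f).
Proof. by apply: plift_linear; [case|case|exact: tlift_rel]. Qed.

Lemma tlift_comb (f1 f2 f3 : V -> W -> T) c t :
  (forall v w, f3 v w = c *: f1 v w + f2 v w) ->
  tlift f3 t = c *: tlift f1 t + tlift f2 t.
Proof.
move=> E; rewrite /tlift /plift; elim: (prepr t) => [[v w]||u Hu u' Hu'|d u Hu|[]] /=.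
- exact: E.
- by rewrite scaler0 addr0.
- by rewrite Hu Hu' scalerDr addrACA.
- by rewrite Hu scalerDr !scalerA mulrC.
Qed.

Lemma tens_ext (g h : tens -> T) : linear g -> linear h ->
  (forall v w, g (tpure v w) = h (tpure v w)) -> g =1 h.
Proof.
move=> lg lh gh.
have lr (k : tens -> T) : linear k -> forall _ : K^o, linear k by [].
have D k (lk : linear k) := bilDr (b := fun _ : K^o => k) (lr k lk) 0.
have Z k (lk : linear k) c := bilZr (b := fun _ : K^o => k) (lr k lk) c 0.
have O k (lk : linear k) := bil0r (b := fun _ : K^o => k) (lr k lk) 0.
apply: tens_ind => //.
- by rewrite !O.
- by move=> s t Hs Ht; rewrite !D // Hs Ht.
- by move=> c t Ht; rewrite !Z // Ht.
Qed.
End Tensor.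

Notation "v ⊗ w" := (tpure v w) (at level 38, no associativity) : ring_scope.

Section Current.
Variables (K : fieldType) (L : lieAlgType K) (A : comAlgType K).

Definition current := tens L A.
HB.instance Definition _ := GRing.Lmodule.on current.

Definition cur_bracket (s t : current) : current :=
  tlift (fun x a => tlift (fun y b => bracket x y ⊗ (a * b)) t) s.

Lemma cur_innerl x a b : linear (fun y : L => bracket x y ⊗ (a * b) : current).
Proof. by move=> c y y'; rewrite bracketDr bracketZr tpure_linl. Qed.
Lemma cur_innerr x a y : linear (fun b : A => bracket x y ⊗ (a * b) : current).
Proof. by move=> c b b'; rewrite mulrDr -scalerAr tpure_linr. Qed.
Lemma cur_midl t a : linear (fun x : L =>
  tlift (fun y b => bracket x y ⊗ (a * b)) t : current).
Proof.
move=> c x x'; apply: tlift_comb => y b.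
by rewrite bracketDl bracketZl tpure_linl.
Qed.
Lemma cur_midr t x : linear (fun a : A =>
  tlift (fun y b => bracket x y ⊗ (a * b)) t : current).
Proof.
move=> c a a'; apply: tlift_comb => y b.
by rewrite mulrDl -scalerAl tpure_linr.
Qed.

Lemma cur_linl t : linear (cur_bracket ^~ t).
Proof. exact: tlift_linear (cur_midl t) (cur_midr t). Qed.
Lemma cur_linr s : linear (cur_bracket s).
Proof.
move=> c t t'; apply: tlift_comb => x a.
exact: (tlift_linear (cur_innerl x a) (cur_innerr x a)).
Qed.
Lemma cur_pure x a y b :
  cur_bracket (x ⊗ a) (y ⊗ b) = bracket x y ⊗ (a * b) :> current.
Proof.
rewrite /cur_bracket tlift_pure; [|exact: cur_midl|exact: cur_midr].
by rewrite tlift_pure //; [exact: cur_innerl|exact: cur_innerr].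
Qed.

Local Notation cDl := (bilDl cur_linl).
Local Notation cDr := (bilDr cur_linr).
Local Notation cZl := (bilZl cur_linl).
Local Notation cZr := (bilZr cur_linr).
Local Notation c0l := (bil0l cur_linl).
Local Notation c0r := (bil0r cur_linr).

Lemma cur_anti s t : cur_bracket s t = - cur_bracket t s.
Proof.
move: s t; apply: tens_ind => [x a|t|s s' Hs Hs' t|c s Hs t].
- apply: tens_ind => [y b||t t' Ht Ht'|c t Ht].
  + rewrite !cur_pure bracketC mulrC.
    exact: (bilNl (@tpure_linl K L A)).
  + by rewrite c0r c0l oppr0.
  + by rewrite cDr cDl opprD Ht Ht'.
  + by rewrite cZr cZl Ht scalerN.
- by rewrite c0r c0l oppr0.
- by rewrite cDr cDl opprD Hs Hs'.
- by rewrite cZr cZl Hs scalerN.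
Qed.

Lemma cur_alt s : cur_bracket s s = 0.
Proof.
move: s; apply: tens_ind => [x a||s t Hs Ht|c s Hs].
- rewrite cur_pure bracket_alt; exact: (bil0l (@tpure_linl K L A)).
- exact: c0l.
- by rewrite cDl !cDr Hs Ht addr0 add0r (cur_anti s t) addNr.
- by rewrite cZl cZr Hs !scaler0.
Qed.

Lemma cur_jacobi s t u :
  cur_bracket s (cur_bracket t u) + cur_bracket t (cur_bracket u s)
    + cur_bracket u (cur_bracket s t) = 0.
Proof.
have sum0D (V : zmodType) (a a' b b' c c' : V) : a + b + c = 0 ->
    a' + b' + c' = 0 -> (a + a') + (b + b') + (c + c') = 0.
  by move=> E E'; rewrite [X in X + _]addrACA [LHS]addrACA E E' addr0.
have sum0Z d (a b c : current) : a + b + c = 0 ->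
    d *: a + d *: b + d *: c = 0.
  by move=> E; rewrite -!scalerDr E scaler0.
move: s t u; apply: tens_ind => [x a|t u|s s' Hs Hs' t u|c s Hs t u].
- apply: tens_ind => [y b|u|t t' Ht Ht' u|c t Ht u].
  + apply: tens_ind => [z c||u u' Hu Hu'|d u Hu].
    * rewrite !cur_pure (mulrCA c a) (mulrC c b) (mulrA b c) (mulrC (b * c)).
      rewrite -!(bilDl (@tpure_linl K L A)) bracket_jacobi.
      exact: (bil0l (@tpure_linl K L A)).
    * by rewrite !(c0r, c0l) !addr0.
    * by rewrite !(cDl, cDr) sum0D.
    * by rewrite !(cZl, cZr) sum0Z.
  + by rewrite !(c0r, c0l) !addr0.
  + by rewrite !(cDl, cDr) sum0D.
  + by rewrite !(cZl, cZr) sum0Z.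
- by rewrite !(c0r, c0l) !addr0.
- by rewrite !(cDl, cDr) sum0D.
- by rewrite !(cZl, cZr) sum0Z.
Qed.
HB.instance Definition _ := isLie.Build K current cur_linl cur_linr
  cur_alt cur_jacobi.

Lemma cur_bracketE x a y b :
  bracket (x ⊗ a : current) (y ⊗ b) = bracket x y ⊗ (a * b).
Proof. exact: cur_pure. Qed.

Section CurrentAction.
Variables (H : lmodType K) (d : der_action H L).

Definition cur_der (h : H) (s : current) : current :=
  tlift (fun x a => d h x ⊗ a) s.

Lemma cur_der_innerl h a : linear (fun x => d h x ⊗ a : current).
Proof. by move=> c x x'; rewrite (der_linr d) tpure_linl. Qed.
Lemma cur_der_innerr h x : linear (fun a => d h x ⊗ a : current).
Proof. by move=> c a a'; rewrite tpure_linr. Qed.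
Lemma cur_der_linr h : linear (cur_der h).
Proof. exact: tlift_linear (cur_der_innerl h) (cur_der_innerr h). Qed.
Lemma cur_der_linl s : linear (cur_der ^~ s).
Proof.
move=> c h h'; apply: tlift_comb => x a.
by rewrite (der_linl d) tpure_linl.
Qed.
Lemma cur_der_pure h x a : cur_der h (x ⊗ a) = d h x ⊗ a.
Proof. exact: tlift_pure (cur_der_innerl h) (cur_der_innerr h) _ _. Qed.

Local Notation dD := (bilDr cur_der_linr).
Local Notation dZ := (bilZr cur_der_linr).
Local Notation d0 := (bil0r cur_der_linr).

Lemma cur_der_leibniz h (s t : current) :
  cur_der h (bracket s t) = bracket (cur_der h s) t + bracket s (cur_der h t).
Proof.
move: s t; apply: tens_ind => [x a|t|s s' Hs Hs' t|c s Hs t].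
- apply: tens_ind => [y b||t t' Ht Ht'|c t Ht].
  + rewrite !cur_der_pure /bracket /= !cur_pure cur_der_pure der_leibniz.
    exact: (bilDl (@tpure_linl K L A)).
  + by rewrite d0 !bracket0r d0 addr0.
  + by rewrite !(bracketDr, dD) Ht Ht' addrACA.
  + by rewrite !(bracketZr, dZ) Ht scalerDr.
- by rewrite d0 !bracket0l d0 addr0.
- by rewrite !(bracketDl, dD) Hs Hs' addrACA.
- by rewrite !(bracketZl, dZ) Hs scalerDr.
Qed.

Lemma cur_der_comm h k (s : current) :
  cur_der h (cur_der k s) = cur_der k (cur_der h s).
Proof.
move: s; apply: tens_ind => [x a||s t Hs Ht|c s Hs].
- by rewrite !cur_der_pure der_comm.
- by rewrite !d0.
- by rewrite !dD Hs Ht.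
- by rewrite !dZ Hs.
Qed.

Definition cur_action : der_action H current :=
  DerAction cur_der_linl cur_der_linr cur_der_leibniz cur_der_comm.
Lemma cur_actionE h x a : cur_action h (x ⊗ a) = d h x ⊗ a.
Proof. exact: cur_der_pure. Qed.
End CurrentAction.
End Current.

Section CopiesAction.
Variables (K : fieldType) (L : lieAlgType K) (I : finType).

Definition ffun_bracket (f g : {ffun I -> L}) : {ffun I -> L} :=
  [ffun i => bracket (f i) (g i)].
Lemma ffun_bracket_linl g : linear (ffun_bracket ^~ g).
Proof.
by move=> c f f'; apply/ffunP => i; rewrite !ffunE bracketDl bracketZl.
Qed.
Lemma ffun_bracket_linr f : linear (ffun_bracket f).
Proof.
by move=> c g g'; apply/ffunP => i; rewrite !ffunE bracketDr bracketZr.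
Qed.
Lemma ffun_bracket_alt f : ffun_bracket f f = 0.
Proof. by apply/ffunP => i; rewrite !ffunE bracket_alt. Qed.
Lemma ffun_bracket_jacobi f g h :
  ffun_bracket f (ffun_bracket g h) + ffun_bracket g (ffun_bracket h f)
    + ffun_bracket h (ffun_bracket f g) = 0.
Proof. by apply/ffunP => i; rewrite !ffunE bracket_jacobi. Qed.
HB.instance Definition _ := isLie.Build K {ffun I -> L} ffun_bracket_linl
  ffun_bracket_linr ffun_bracket_alt ffun_bracket_jacobi.

Variables (H : lmodType K) (d : der_action H L).
Definition ffun_der (h : H) (f : {ffun I -> L}) : {ffun I -> L} :=
  [ffun i => d h (f i)].
Lemma ffun_der_linl f : linear (ffun_der ^~ f).
Proof. by move=> c h h'; apply/ffunP => i; rewrite !ffunE (der_linl d). Qed.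
Lemma ffun_der_linr h : linear (ffun_der h).
Proof. by move=> c f f'; apply/ffunP => i; rewrite !ffunE (der_linr d). Qed.
Lemma ffun_der_leibniz h (f g : {ffun I -> L}) :
  ffun_der h (bracket f g) = bracket (ffun_der h f) g + bracket f (ffun_der h g).
Proof. by apply/ffunP => i; rewrite !ffunE der_leibniz. Qed.
Lemma ffun_der_comm h k f : ffun_der h (ffun_der k f) = ffun_der k (ffun_der h f).
Proof. by apply/ffunP => i; rewrite !ffunE der_comm. Qed.
Definition ffun_action : der_action H {ffun I -> L} :=
  DerAction ffun_der_linl ffun_der_linr ffun_der_leibniz ffun_der_comm.
End CopiesAction.


Section IdealQuotAlgebra.
Variables (K : fieldType) (A : comAlgType K) (J : idealr A).
Local Notation Q := (Quotient.quot J).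

Lemma idealr_scale (c : K) a : a \in J -> c *: a \in J.
Proof. by move=> Ja; rewrite -[a]mul1r scalerAl idealMr. Qed.

Definition iq_scale (c : K) (q : Q) : Q := \pi_Q (c *: repr q).
Lemma pi_scale c (a : A) : \pi_Q (c *: a) = iq_scale c (\pi_Q a).
Proof.
apply/eqP; rewrite -Quotient.idealrBE -scalerBr idealr_scale //.
by rewrite Quotient.idealrBE reprK.
Qed.
Lemma iq_scaleA a b q : iq_scale a (iq_scale b q) = iq_scale (a * b) q.
Proof.
by rewrite -[q]reprK -(pi_scale b) -(pi_scale a) -(pi_scale (a * b)) scalerA.
Qed.
Lemma iq_scale1 : left_id 1 iq_scale.
Proof. by move=> q; rewrite -[q]reprK -pi_scale scale1r. Qed.
Lemma iq_scaleDr : right_distributive iq_scale +%R.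
Proof.
by move=> c p q; rewrite -[p]reprK -[q]reprK -rmorphD -!pi_scale -rmorphD scalerDr.
Qed.
Lemma iq_scaleDl q : {morph iq_scale^~ q : a b / a + b}.
Proof.
by move=> a b; rewrite /= -[q]reprK -!pi_scale -rmorphD scalerDl.
Qed.
HB.instance Definition _ := GRing.Zmodule_isLmodule.Build K Q
  iq_scaleA iq_scale1 iq_scaleDr iq_scaleDl.
Lemma pi_scaleE c (a : A) : \pi_Q (c *: a) = c *: \pi_Q a.
Proof. exact: pi_scale. Qed.
Lemma iq_scaleAl (c : K) (p q : Q) : c *: (p * q) = (c *: p) * q.
Proof.
by rewrite -[p]reprK -[q]reprK -rmorphM -!pi_scaleE -rmorphM scalerAl.
Qed.
HB.instance Definition _ := GRing.Lmodule_isLalgebra.Build K Q iq_scaleAl.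
HB.instance Definition _ := GRing.Lalgebra_isComAlgebra.Build K Q.
End IdealQuotAlgebra.

Record lie_mod (K : fieldType) (L : lieAlgType K) (V : lmodType K) := LieMod {
  lact :> L -> V -> V;
  lact_linl : forall v, linear (lact ^~ v);
  lact_linr : forall x, linear (lact x);
  lact_bracket : forall x y v,
    lact (bracket x y) v = lact x (lact y v) - lact y (lact x v)
}.

Section Enveloping.
Variables (K : fieldType) (L : lieAlgType K).
Local Notation tm := (term K unit (option L)).

(* Generators: Some x for x in L, and None for the unit. *)
Inductive env_rel : tm -> tm -> Prop :=
| er_lin c x y : env_rel (Gen (Some (c *: x + y)))
    (Add (Scale c (Gen (Some x))) (Gen (Some y)))
| er_bracket x y : env_rel (Gen (Some (bracket x y)))
    (Add (Op tt (Gen (Some x)) (Gen (Some y)))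
         (Scale (-1) (Op tt (Gen (Some y)) (Gen (Some x)))))
| er_mulA t u w : env_rel (Op tt t (Op tt u w)) (Op tt (Op tt t u) w)
| er_mul1l t : env_rel (Op tt (Gen None) t) t
| er_mul1r t : env_rel (Op tt t (Gen None)) t.

Definition env := pres env_rel.
HB.instance Definition _ := GRing.Lmodule.on env.
Definition env_one : env := pgen env_rel None.
Definition env_gen (x : L) : env := pgen env_rel (Some x).

Lemma env_mulA : associative (pop tt : env -> env -> env).
Proof.
move=> x y z; rewrite -[x]preprK -[y]preprK -[z]preprK -!ppiM.
by apply/ppiP/pc_rel; constructor.
Qed.
Lemma env_mul1l : left_id env_one (pop tt : env -> env -> env).
Proof.
by move=> x; rewrite -[x]preprK -ppiM; apply/ppiP/pc_rel; constructor.
Qed.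
Lemma env_mul1r : right_id env_one (pop tt : env -> env -> env).
Proof.
by move=> x; rewrite -[x]preprK -ppiM; apply/ppiP/pc_rel; constructor.
Qed.
Lemma env_mulDl : left_distributive (pop tt : env -> env -> env) +%R.
Proof. exact: (bilDl (pop_linl (R := env_rel) tt)). Qed.
Lemma env_mulDr : right_distributive (pop tt : env -> env -> env) +%R.
Proof. exact: (bilDr (pop_linr (R := env_rel) tt)). Qed.

Lemma env_one_neq0 : env_one != 0.
Proof.
pose f (o : option L) : K^o := if o is Some _ then 0 else 1.
pose m (_ : unit) (a b : K^o) : K^o := a * b.
have ml o w : linear (m o ^~ w) by move=> c x y; rewrite /m mulrDl scalerAl.
have mr o w : linear (m o w) by move=> c x y; rewrite /m mulrDr scalerAr.
have fR t u : env_rel t u -> eval m f t = eval m f u.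
  case=> [c x y|x y|t' u' w|t'|t'] /=; rewrite /m ?scaler0 ?addr0 //.
  - by rewrite mulr0 scaler0 addr0.
  - by rewrite mulrA.
  - by rewrite mul1r.
  - by rewrite mulr1.
apply/eqP => /(congr1 (plift m f)); rewrite (plift_gen ml mr fR).
rewrite -(ppi0 env_rel) (plift_ppi ml mr fR) /= => /eqP.
by rewrite oner_eq0.
Qed.

HB.instance Definition _ := GRing.Zmodule_isNzRing.Build env
  env_mulA env_mul1l env_mul1r env_mulDl env_mulDr env_one_neq0.
Lemma env_scaleAl (c : K) (u v : env) : c *: (u * v) = (c *: u) * v.
Proof. exact/esym/(bilZl (pop_linl (R := env_rel) tt)). Qed.
HB.instance Definition _ := GRing.Lmodule_isLalgebra.Build K env env_scaleAl.
Lemma env_scaleAr (c : K) (u v : env) : c *: (u * v) = u * (c *: v).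
Proof. exact/esym/(bilZr (pop_linr (R := env_rel) tt)). Qed.
HB.instance Definition _ := GRing.Lalgebra_isAlgebra.Build K env env_scaleAr.

Lemma env_gen_linear : linear env_gen.
Proof.
move=> c x y; rewrite /env_gen /pgen -ppi_scale -ppi_add.
by apply/ppiP/pc_rel; constructor.
Qed.
Lemma env_gen_bracket x y :
  env_gen (bracket x y) = env_gen x * env_gen y - env_gen y * env_gen x.
Proof.
have M t u : ppi env_rel (Op tt t u) = (ppi _ t : env) * ppi _ u by exact: ppiM.
rewrite -scaleN1r /env_gen /pgen -!M -ppi_scale -ppi_add.
by apply/ppiP/pc_rel; constructor.
Qed.

Section EnvAction.
Variables (V : lmodType K) (m : lie_mod L V).

Fixpoint env_tact (t : tm) : V -> V :=
  match t with
  | Gen (Some x) => m x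
  | Gen None => id
  | Zero => fun _ => 0
  | Add t u => fun v => env_tact t v + env_tact u v
  | Scale c t => fun v => c *: env_tact t v
  | Op _ t u => fun v => env_tact t (env_tact u v)
  end.

Lemma env_tact_linear t : linear (env_tact t).
Proof.
elim: t => [[x|]||t Ht u Hu|d t Ht|o t Ht u Hu] c v w //=.
- exact: lact_linr.
- by rewrite scaler0 addr0.
- by rewrite Ht Hu scalerDr addrACA.
- by rewrite Ht scalerDr !scalerA mulrC.
- by rewrite Hu Ht.
Qed.

Lemma env_tact_pcong t u : pcong env_rel t u -> env_tact t =1 env_tact u.
Proof.
have lD s v w : env_tact s (v + w) = env_tact s v + env_tact s w.
  by have := env_tact_linear s 1 v w; rewrite !scale1r.
have l0 s : env_tact s 0 = 0.
  by apply: (addrI (env_tact s 0)); rewrite -lD !addr0.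
have lZ s c v : env_tact s (c *: v) = c *: env_tact s v.
  by have := env_tact_linear s c v 0; rewrite !addr0 l0 addr0.
elim=> //= {t u}.
- move=> t u [c x y|x y|{}t {}u w|{}t|{}t] v //=.
    exact: lact_linl.
  by rewrite lact_bracket scaleN1r.
- by move=> t u _ IH v; rewrite IH.
- by move=> t u w _ IH _ IH' v; rewrite IH IH'.
- by move=> t t' u u' _ IH _ IH' v; rewrite IH IH'.
- by move=> c t t' _ IH v; rewrite IH.
- by move=> _ t t' u u' _ IH _ IH' v; rewrite IH' IH.
- by move=> t u w v; rewrite addrA.
- by move=> t u v; rewrite addrC.
- by move=> t v; rewrite add0r.
- by move=> t v; rewrite scaleN1r addNr.
- by move=> a b t v; rewrite scalerA.
- by move=> t v; rewrite scale1r.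
- by move=> a t u v; rewrite scalerDr.
- by move=> a b t v; rewrite scalerDl.
- by move=> _ t u w v; rewrite lD.
- by move=> _ c t w v; rewrite lZ.
Qed.

Definition env_act (u : env) : V -> V := env_tact (prepr u).
Lemma env_act_gen x v : env_act (env_gen x) v = m x v.
Proof. exact: (env_tact_pcong (prepr_ppi env_rel (Gen (Some x)))). Qed.
End EnvAction.
End Enveloping.

Section Induced.
Variables (K : fieldType) (L : lieAlgType K) (B : lieClosed L).
Local Notation b := (sublie B).

Definition env_incl (u : env b) : env L :=
  plift (fun _ => *%R) (fun o => if o is Some x then env_gen (val x) else 1) u.

Variables (N : lmodType K) (m : lie_mod b N).
Local Notation tm := (term K void (env L * N)).

(* U(L) is a right U(B)-module through env_incl. *)
Inductive ind_rel : tm -> tm -> Prop :=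
| ir_linl c u u' n : ind_rel (Gen (c *: u + u', n))
    (Add (Scale c (Gen (u, n))) (Gen (u', n)))
| ir_linr c u n n' : ind_rel (Gen (u, c *: n + n'))
    (Add (Scale c (Gen (u, n))) (Gen (u, n')))
| ir_bal u s n : ind_rel (Gen (u * env_incl s, n)) (Gen (u, env_act m s n)).

Definition induced := pres ind_rel.
HB.instance Definition _ := GRing.Lmodule.on induced.
Definition ind_pure (u : env L) (n : N) : induced := pgen ind_rel (u, n).

Lemma ind_pure_linl n : linear (ind_pure ^~ n).
Proof.
move=> c u v; rewrite /ind_pure /pgen -ppi_scale -ppi_add.
by apply/ppiP/pc_rel; constructor.
Qed.
Lemma ind_pure_bal u s n : ind_pure (u * env_incl s) n = ind_pure u (env_act m s n).
Proof. by apply/ppiP/pc_rel; constructor. Qed.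
Lemma ind_pure_linr u : linear (ind_pure u).
Proof.
move=> c n n'; rewrite /ind_pure /pgen -ppi_scale -ppi_add.
by apply/ppiP/pc_rel; constructor.
Qed.

Definition ind_act (x : L) (p : induced) : induced :=
  plift (@no_op induced) (fun un => ind_pure (env_gen x * un.1) un.2) p.

Lemma ind_act_rel x t u : ind_rel t u ->
  eval (@no_op induced) (fun un => ind_pure (env_gen x * un.1) un.2) t =
  eval (@no_op induced) (fun un => ind_pure (env_gen x * un.1) un.2) u.
Proof.
case=> [c v v' n|c v n n'|v s n] /=.
- by rewrite mulrDr -scalerAr ind_pure_linl.
- by rewrite ind_pure_linr.
- by rewrite mulrA ind_pure_bal.
Qed.
Lemma ind_act_pure x u n : ind_act x (ind_pure u n) = ind_pure (env_gen x * u) n.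
Proof. by apply: plift_gen; [case|case|exact: ind_act_rel]. Qed.
Lemma ind_act_linr x : linear (ind_act x).
Proof. by apply: plift_linear; [case|case|exact: ind_act_rel]. Qed.

Lemma induced_ind (P : induced -> Prop) :
  (forall u n, P (ind_pure u n)) -> P 0 ->
  (forall s t, P s -> P t -> P (s + t)) ->
  (forall c t, P t -> P (c *: t)) -> forall t, P t.
Proof. by move=> Hg H0 HD HZ; apply: pres_ind => //; case=> *; exact: Hg. Qed.

Local Notation aD := (bilDr ind_act_linr).
Local Notation aZ := (bilZr ind_act_linr).
Local Notation a0 := (bil0r ind_act_linr).

Lemma ind_act_linl v : linear (ind_act ^~ v).
Proof.
move=> c x y; move: v; apply: induced_ind => [u n||s t Hs Ht|d t Ht].
- by rewrite !ind_act_pure env_gen_linear mulrDl -scalerAl ind_pure_linl.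
- by rewrite !a0 scaler0 addr0.
- by rewrite !aD Hs Ht scalerDr addrACA.
- by rewrite !aZ Ht scalerDr !scalerA mulrC.
Qed.
Lemma ind_act_bracket x y v :
  ind_act (bracket x y) v = ind_act x (ind_act y v) - ind_act y (ind_act x v).
Proof.
move: v; apply: induced_ind => [u n||s t Hs Ht|d t Ht].
- rewrite !ind_act_pure env_gen_bracket mulrBl -!mulrA.
  by rewrite (bilDl ind_pure_linl) (bilNl ind_pure_linl).
- by rewrite !a0 subrr.
- by rewrite !aD Hs Ht opprD addrACA.
- by rewrite !aZ Ht scalerBr.
Qed.

Definition ind_mod : lie_mod L induced :=
  LieMod ind_act_linl ind_act_linr ind_act_bracket.
End Induced.

Section ModuleNotions.
Variables (K : fieldType) (L : lieAlgType K).

Definition lie_mod_hom (V W : lmodType K) (m : lie_mod L V) (m' : lie_mod L W)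
    (f : V -> W) : Prop :=
  linear f /\ forall x v, f (m x v) = m' x (f v).

Definition submodule (V : lmodType K) (m : lie_mod L V) (S : submodClosed V) :=
  forall x v, v \in S -> m x v \in S.

Definition irreducible (V : lmodType K) (m : lie_mod L V) : Prop :=
  (exists v : V, v <> 0) /\
  forall S : submodClosed V, submodule m S ->
    (forall v, v \in S -> v = 0) \/ (forall v, v \in S).

End ModuleNotions.


Definition gcm (n : nat) (A : 'M[int]_n) : Prop :=
  [/\ forall i, A i i = 2,
      forall i j, i != j -> A i j <= 0
    & forall i j, A i j = 0 -> A j i = 0].

Record realization (K : fieldType) (n : nat) (A : 'M[int]_n) (h : vectType K) :=
  Realization {
    coroot : 'I_n -> h;
    root : 'I_n -> 'Hom(h, K^o);
    coroot_free : free (codom coroot);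
    root_free : free (codom root);
    root_coroot : forall i j, root j (coroot i) = (A i j)%:~R :> K;
    realization_dim :
      (\dim {:h} + \rank (map_mx intr A : 'M[K]_n) = n.*2)%N
  }.

(* The Kac-Moody algebra of a generalized Cartan matrix A, after Kac: the Lie
   algebra [km_tilde] generated by h, e_i, f_i with the Chevalley relations,
   modulo its largest ideal meeting h trivially.  h is kept as the space of the
   realization, embedded in g = [km] by [km_h].  Below
     [kmp] = g' = [g, g],          [km_hp] = h', a subspace of h,
     [km_nplus] = N^+,             [h2] = h'', a subspace of h,
     [ckm] = (g' ⊗ Q) ⊕ h'',      [copies_km] = (g' ⊕ ... ⊕ g') ⊕ h'',
     [cartan_cur] = (h' ⊗ Q) ⊕ h'',
     [borel] = (N^+ ⊗ Q) ⊕ (h' ⊗ Q) ⊕ h''. *)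
Section KacMoody.
Variables (K : fieldType) (n : nat) (A : 'M[int]_n) (h : vectType K).
Variable rl : realization A h.

Inductive km_gen := kH of h | kE of 'I_n | kF of 'I_n.
Local Notation tm := (term K unit km_gen).
Local Notation H x := (Gen (kH x)).
Local Notation E i := (Gen (kE i)).
Local Notation F i := (Gen (kF i)).
Local Notation br := (Op tt).

Inductive km_rel : tm -> tm -> Prop :=
| kr_lin c x y : km_rel (H (c *: x + y)) (Add (Scale c (H x)) (H y))
| kr_hh x y : km_rel (br (H x) (H y)) Zero
| kr_he x i : km_rel (br (H x) (E i)) (Scale (root rl i x : K) (E i))
| kr_hf x i : km_rel (br (H x) (F i)) (Scale (- root rl i x : K) (F i))
| kr_ef i : km_rel (br (E i) (F i)) (H (coroot rl i))
| kr_ef0 i j : i != j -> km_rel (br (E i) (F j)) Zero.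

Definition km_tilde := lie_pres km_rel.
HB.instance Definition _ := LieAlg.on km_tilde.
Definition tilde_h (x : h) : km_tilde := lie_gen km_rel (kH x).

Definition ideal_off_h (I : lieIdeal km_tilde) : Prop :=
  forall x, tilde_h x \in I -> tilde_h x = 0.

(* The largest ideal meeting h trivially: it is the sum of all such ideals. *)
Definition km_rad : {pred km_tilde} :=
  span_of (fun x => exists I : lieIdeal km_tilde, ideal_off_h I /\ x \in I).
HB.instance Definition _ := GRing.SubmodClosed.on km_rad.
Lemma km_rad_ideal (x y : km_tilde) : y \in km_rad -> bracket x y \in km_rad.
Proof.
move: y; apply: span_ind => [|c y y' Hy Hy'|y [I [HI yI]]].
- by rewrite bracket0r rpred0.
- by rewrite bracketDr bracketZr rpredD ?rpredZ.
by apply: mem_span; exists I; split; rewrite ?lieideal.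
Qed.
HB.instance Definition _ := isLieIdeal.Build K km_tilde km_rad km_rad_ideal.

Definition km := quotlie km_rad.
HB.instance Definition _ := LieAlg.on km.
Definition km_h (x : h) : km := qlpi km_rad (tilde_h x).

Lemma km_h_linear : linear km_h.
Proof.
move=> c x y; rewrite /km_h -qlpiZ -qlpiD; congr qlpi.
rewrite /tilde_h /lie_gen /pgen -ppi_scale -ppi_add.
by apply/ppiP/pc_rel/lr_rel; constructor.
Qed.
Lemma km_h0 : km_h 0 = 0.
Proof.
have := km_h_linear (-1) 0 0.
by rewrite scaleN1r oppr0 addr0 scaleN1r addNr.
Qed.
Lemma km_hh x y : bracket (km_h x) (km_h y) = 0.
Proof.
rewrite /km_h -[LHS]qlpi_lie -[RHS](_ : qlpi km_rad 0 = 0) //; congr qlpi.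
rewrite /tilde_h /lie_gen /pgen lie_pres_bracket -ppi0.
by apply/ppiP/pc_rel/lr_rel; constructor.
Qed.

Definition root_space (al : 'Hom(h, K^o)) (x : km) : Prop :=
  forall y : h, bracket (km_h y) x = (al y : K) *: x.

Definition pos_root (al : 'Hom(h, K^o)) : Prop :=
  (exists k : 'I_n -> nat,
     (exists i, k i <> 0) /\ al = \sum_i root rl i *+ k i) /\
  (exists x, root_space al x /\ x <> 0).

Definition km_nplus : {pred km} :=
  span_of (fun x => exists al, pos_root al /\ root_space al x).
HB.instance Definition _ := GRing.SubmodClosed.on km_nplus.

Lemma root_space_bracket al be x y : root_space al x -> root_space be y ->
  root_space (al + be) (bracket x y).
Proof.
move=> Hx Hy z; rewrite bracket_leibniz Hx Hy bracketZl bracketZr.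
by rewrite -scalerDl add_lfunE.
Qed.

Lemma nplus_h z x : x \in km_nplus -> bracket (km_h z) x \in km_nplus.
Proof.
move: x; apply: span_ind => [|c x y Hx Hy|x [al [Hal Hx]]].
- by rewrite bracket0r rpred0.
- by rewrite bracketDr bracketZr rpredD ?rpredZ.
by rewrite Hx rpredZ //; apply: mem_span; exists al.
Qed.

Lemma nplus_bracket x y :
  x \in km_nplus -> y \in km_nplus -> bracket x y \in km_nplus.
Proof.
move: x y; apply: span_bracket => x y [al [[[k [[i ki] ->]] _] Hx]].
case=> be [[[k' [_ ->]] _] Hy].
have Hxy := root_space_bracket Hx Hy.
have [->|/eqP xy0] := eqVneq (bracket x y) 0; first by rewrite rpred0.
apply: mem_span; eexists; split; last exact: Hxy.
split; last by exists (bracket x y).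
exists (fun i => (k i + k' i)%N); split.
  by exists i => /eqP; rewrite addn_eq0 => /andP [/eqP].
by rewrite -big_split; apply: eq_bigr => j _; rewrite mulrnDr.
Qed.

Inductive real_root : 'Hom(h, K^o) -> Prop :=
| rr_simple i : real_root (root rl i)
| rr_reflect i al : real_root al ->
    real_root (al - (al (coroot rl i) : K) *: root rl i).

Definition kmp := sublie (derived km).
HB.instance Definition _ := LieAlg.on kmp.

Definition km_hp : {pred h} := [pred x | km_h x \in derived km].
Lemma km_hp_submod : submod_closed km_hp.
Proof.
have E x : (x \in km_hp) = (km_h x \in derived km) by [].
split=> [|c x y]; rewrite !E; last first.
  by move=> Hx Hy; rewrite km_h_linear rpredD ?rpredZ.
by rewrite km_h0 rpred0.
Qed.
HB.instance Definition _ := GRing.isSubmodClosed.Build K h km_hp km_hp_submod.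
Definition hp_incl (x : sub_of km_hp) : kmp :=
  SubOf (sub_valP x : km_h (sub_val x) \in derived km).

Definition complement_hp (h2 : submodClosed h) : Prop :=
  (forall x, exists y z, [/\ y \in km_hp, z \in h2 & x = y + z]) /\
  (forall x, x \in km_hp -> x \in h2 -> x = 0).

Variable h2 : submodClosed h.

Definition h2_der (y : sub_of h2) (x : kmp) : kmp :=
  SubOf (derived_bracket (km_h (val y)) (val x)).
Lemma h2_der_linl x : linear (h2_der ^~ x).
Proof.
move=> c y y'; apply: val_inj; rewrite [LHS]/= [RHS]/=.
by rewrite km_h_linear bracketDl bracketZl.
Qed.
Lemma h2_der_linr y : linear (h2_der y).
Proof.
move=> c x x'; apply: val_inj; rewrite [LHS]/= [RHS]/=.
by rewrite bracketDr bracketZr.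
Qed.
Lemma h2_der_leibniz y (x x' : kmp) :
  h2_der y (bracket x x') = bracket (h2_der y x) x' + bracket x (h2_der y x').
Proof. by apply: val_inj; rewrite /= bracket_leibniz. Qed.
Lemma h2_der_comm y z x : h2_der y (h2_der z x) = h2_der z (h2_der y x).
Proof.
by apply: val_inj; rewrite /= bracket_leibniz km_hh bracket0l add0r.
Qed.
Definition h2_action : der_action (sub_of h2) kmp :=
  DerAction h2_der_linl h2_der_linr h2_der_leibniz h2_der_comm.

Section CurrentKM.
Variable Q : comAlgType K.
Definition ckm := semidir (cur_action Q h2_action).
HB.instance Definition _ := LieAlg.on ckm.
Definition ckm_g (x : kmp) (a : Q) : ckm := (x ⊗ a, 0).
Definition ckm_h2 (y : sub_of h2) : ckm := (0, y).
End CurrentKM.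

Definition copies_km (k : nat) := semidir (ffun_action 'I_k h2_action).
HB.instance Definition _ k := LieAlg.on (copies_km k).

Section Borel.
Variable Q : comAlgType K.
Local Notation gQ := (ckm Q).

Definition cartan_cur : Type := (tens (sub_of km_hp) Q * sub_of h2)%type.
HB.instance Definition _ := GRing.Lmodule.on cartan_cur.
Definition cartan_incl (p : cartan_cur) : gQ :=
  (tlift (fun x a => hp_incl x ⊗ a : current kmp Q) p.1, p.2).

Definition borel_gen (p : gQ) : Prop :=
  [\/ exists x a, val x \in km_nplus /\ p = ckm_g x a,
      exists x a, p = ckm_g (hp_incl x) a
    | exists y, p = ckm_h2 Q y].
Definition borel : {pred gQ} := span_of borel_gen.
HB.instance Definition _ := GRing.SubmodClosed.on borel.

Lemma borel_bracket x y :
  x \in borel -> y \in borel -> bracket x y \in borel.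
Proof.
pose d := cur_action Q h2_action.
have d0 (s : current kmp Q) : d 0 s = 0 by rewrite (bil0l (der_linl d)).
have D0 k : d k 0 = 0 by rewrite (bil0r (der_linr d)).
have gg x0 a y0 b : bracket (ckm_g x0 a) (ckm_g y0 b) =
    ckm_g (bracket x0 y0) (a * b) :> gQ.
  by rewrite [LHS]semidir_bracketE !d0 subr0 addr0 cur_bracketE.
have g0 (x0 : kmp) a : val x0 = 0 -> ckm_g x0 a = 0 :> gQ.
  move=> E; rewrite (_ : x0 = 0); last exact: val_inj.
  by rewrite /ckm_g (bil0l (@tpure_linl _ _ _)).
have hg k x0 a : bracket (ckm_h2 Q k) (ckm_g x0 a) = ckm_g (h2_der k x0) a.
  by rewrite [LHS]semidir_bracketE bracket0l d0 add0r subr0 cur_actionE.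
have hh k k' : bracket (ckm_h2 Q k) (ckm_h2 Q k') = 0.
  by rewrite [LHS]semidir_bracketE bracket0l !D0 subr0 addr0.
have sw u v : bracket u v \in borel -> bracket v u \in borel.
  by move=> H; rewrite bracketC -scaleN1r rpredZ.
have inN x0 a : val x0 \in km_nplus -> ckm_g x0 a \in borel.
  by move=> Hx; apply: mem_span; constructor 1; exists x0, a.
have in0 u : u = 0 -> u \in borel by move=> ->; rewrite rpred0.
have hN z x0 b y0 : val y0 \in km_nplus ->
    bracket (ckm_g (hp_incl z) x0) (ckm_g y0 b) \in borel.
  by move=> Hy; rewrite gg; apply/inN/nplus_h.
apply: span_bracket => {}x {}y.
case=> [[x0 [a [Hx ->]]]|[x0 [a ->]]|[k ->]];
  case=> [[y0 [b [Hy ->]]]|[y0 [b ->]]|[k' ->]].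
- by rewrite gg; apply/inN/nplus_bracket.
- by apply/sw/hN.
- by apply: sw; rewrite hg; apply/inN/nplus_h.
- exact: hN.
- by apply: in0; rewrite gg; apply/g0/km_hh.
- by apply/sw/in0; rewrite hg; apply/g0/km_hh.
- by rewrite hg; apply/inN/nplus_h.
- by apply: in0; rewrite hg; apply/g0/km_hh.
- exact/in0/hh.
Qed.
HB.instance Definition _ := isLieClosed.Build K gQ borel borel_bracket.

(* c is the module structure of C(psi) on the one-dimensional space K. *)
Definition is_Cpsi (psi : {linear cartan_cur -> K^o})
    (c : lie_mod (sublie borel) K^o) : Prop :=
  (forall (x : kmp) a (b : sublie borel), val x \in km_nplus ->
     val b = ckm_g x a -> forall z, c b z = 0) /\
  (forall (p : cartan_cur) (b : sublie borel),
     val b = cartan_incl p -> forall z, c b z = (psi p : K) *: z).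

(* The module act is V(psi), the irreducible quotient of
   M(psi) = U(g_A) ⊗_{U(B)} C(psi). *)
Definition is_Vpsi (psi : {linear cartan_cur -> K^o})
    (V : lmodType K) (act : lie_mod (ckm Q) V) : Prop :=
  irreducible act /\
  exists c : lie_mod (sublie borel) K^o, is_Cpsi psi c /\
  exists pi : induced c -> V,
    lie_mod_hom (ind_mod c) act pi /\ forall v, exists u, pi u = v.
End Borel.

Section Integrable.
Variables (Q : comAlgType K) (V : lmodType K) (act : lie_mod (ckm Q) V).

(* h acts through its embedding as (h' ⊗ 1) ⊕ h'' in g_A. *)
Definition weight_space (lam : 'Hom(h, K^o)) (v : V) : Prop :=
  forall (x : sub_of km_hp) (y : sub_of h2),
    act ((hp_incl x ⊗ 1, y) : ckm Q) v = (lam (val x + val y) : K) *: v.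

Definition weight_module : Prop :=
  (forall v, exists m (lam : 'I_m -> 'Hom(h, K^o)) (w : 'I_m -> V),
     (forall i, weight_space (lam i) (w i)) /\ v = \sum_i w i) /\
  (forall m (lam : 'I_m -> 'Hom(h, K^o)) (w : 'I_m -> V), injective lam ->
     (forall i, weight_space (lam i) (w i)) -> \sum_i w i = 0 ->
     forall i, w i = 0).

Definition integrable : Prop :=
  weight_module /\
  forall (al : 'Hom(h, K^o)) (X : kmp), real_root al -> root_space al (val X) ->
  forall (a : Q) (v : V), exists k : nat,
    (0 < k)%N /\ iter k (act (ckm_g X a)) v = 0.

Definition finite_weight_spaces : Prop :=
  forall lam, exists m (s : 'I_m -> V),
    (forall i, weight_space lam (s i)) /\
    (forall v, weight_space lam v ->
       exists c : 'I_m -> K, v = \sum_i c i *: s i).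

End Integrable.

Section Reduction.
Variables (Q : comAlgType K) (J : idealr Q).
Local Notation QJ := {ideal_quot J}.

Definition ckm_proj (p : ckm Q) : ckm QJ :=
  (tlift (fun x a => x ⊗ \pi_QJ a : current kmp QJ) p.1, p.2).

Definition induced_by k (phi : QJ -> {ffun 'I_k -> K^o})
    (theta : ckm QJ -> copies_km k) : Prop :=
  forall (x : kmp) (a : QJ) (y : sub_of h2),
    theta (x ⊗ a, y) = ([ffun i => (phi a i : K) *: x], y).
End Reduction.

End KacMoody.


Definition finitely_generated (K : fieldType) (A : comAlgType K) : Prop :=
  exists s : seq A, forall S : {pred A}, GRing.subalg_closed S ->
    {subset s <= S} -> forall a, a \in S.

Definition radical (A : comNzRingType) (J : {pred A}) (a : A) : Prop :=
  exists n : nat, (0 < n)%N /\ a ^+ n \in J.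

Definition radical_ideal (A : comNzRingType) (J : {pred A}) : Prop :=
  forall a, radical J a <-> a \in J.

Definition alg_iso (K : fieldType) (A : comAlgType K) k
    (phi : A -> {ffun 'I_k -> K^o}) : Prop :=
  [/\ linear phi, phi 1 = 1, {morph phi : a b / a * b} & bijective phi].

(* Main.v *)
Require Import Defs.
From HB Require Import structures.
From mathcomp Require Import all_boot all_order all_algebra reals complex.
From mathcomp Require Import boolp classical_sets ring lra.
Set Implicit Arguments.
Unset Strict Implicit.
Unset Printing Implicit Defensive.
Import Order.TTheory GRing.Theory Num.Theory.
Local Open Scope ring_scope.
Local Open Scope quotient_scope.

(** Let v be a highest weight vector of V and let I be the set of the a in A
    such that (f_i ⊗ a) v = 0 for every simple root index i.  The proof rests
    on three properties of I.

    I is an ideal that annihilates V: if a is in I, then g' ⊗ a acts as zero.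
    In an irreducible module a vector killed by all e_j ⊗ b that lies strictly
    below v is zero ([singular_vector]), because the submodule it generates
    stays strictly below v.  By induction on the length of a word u in the
    f_i ⊗ b applied to v, the vector (f_j ⊗ a) u is of this kind, hence zero
    ([vanishing_lowered]); such words span V ([generated_by_v]), and the e_j and
    f_j generate g' ([kmp_ind]).

    I is radical: if b^2 is in I, then h_i ⊗ c b commutes with f_i ⊗ b on V, so
    (e_i ⊗ c) (f_i ⊗ b)^k v = k mu_c (f_i ⊗ b)^(k-1) v, where mu_c is the
    eigenvalue of h_i ⊗ c b on v.  Integrability makes f_i ⊗ b nilpotent on v,
    which forces mu_c = 0 in characteristic 0; then (f_i ⊗ b) v is killed by
    all e_j ⊗ c, hence zero ([vanishing_sqr]).

    I has finite codimension: the vectors (f_i ⊗ a) v lie in finitely many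
    weight spaces, which are finite-dimensional ([lowering_cofinite]).

    A radical ideal of finite codimension over an algebraically closed field is
    the intersection of the kernels of finitely many algebra maps A -> C
    ([radical_family]), and distinct such maps are jointly surjective
    ([separating_elements]).  Therefore A/I is C^k, and g' ⊗ A/I is a direct sum
    of k copies of g' ([split_copies_iso]).  When I = A, as for the trivial
    module, this gives k = 0; the kernel of any single algebra map A -> C serves
    instead, and one exists by the weak Nullstellensatz
    ([weak_nullstellensatz]).  The latter is proved by counting: A has countable
    dimension, whereas a transcendental element t of a quotient field of A would
    give the uncountable independent family of the 1/(t - c). *)

(** * Uncountability of the complex numbers and linear dependence *)

Section Reals.
Variable R : realType.

(** Nested intervals: each step shrinks the interval so as to exclude the next value
    of [f], and the supremum of the left end points lies in all the intervals. *)
Lemma real_not_enumerable (f : nat -> R) : exists x, forall k, f k != x.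
Proof.
pose step (I : R * R) (x : R) :=
  if x < (I.1 + I.2) / 2 then ((I.1 + I.2) / 2, I.2)
  else (I.1, (3 * I.1 + I.2) / 4).
pose iv := fix iv k := if k is k.+1 then step (iv k) (f k) else (0, 1).
have ivS k : iv k.+1 = step (iv k) (f k) by [].
have step_lt I x : I.1 < I.2 -> (step I x).1 < (step I x).2.
  by rewrite /step; case: ifP => _ /=; lra.
have step_sub I x : I.1 < I.2 -> I.1 <= (step I x).1 /\ (step I x).2 <= I.2.
  by rewrite /step; case: ifP => _ /= ltI; split => //; lra.
have step_out I x : I.1 < I.2 -> (step I x).1 <= x <= (step I x).2 -> False.
  by rewrite /step; case: ifPn => /=; lra.
have iv_lt k : (iv k).1 < (iv k).2.
  by elim: k => [|k IH]; rewrite ?ltr01 // ivS; exact: step_lt.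
have iv_step k : (iv k).1 <= (iv k.+1).1 /\ (iv k.+1).2 <= (iv k).2.
  by rewrite ivS; exact: step_sub.
clearbody iv.
have iv_mono k m : (iv k).1 <= (iv (k + m)%N).1 /\ (iv (k + m)%N).2 <= (iv k).2.
  elim: m => [|m [IH1 IH2]]; rewrite ?addn0 ?lexx // addnS.
  have [H1 H2] := iv_step (k + m)%N.
  by split; [exact: le_trans IH1 H1|exact: le_trans H2 IH2].
have iv_cross k m : (iv k).1 <= (iv m).2.
  have [H1 _] := iv_mono k m; have [_ H2] := iv_mono m k.
  rewrite addnC in H2.
  exact: le_trans H1 (le_trans (ltW (iv_lt _)) H2).
pose E : set R := fun x => exists k, x = (iv k).1.
have ubE k : ubound E (iv k).2 by move=> _ [m ->].
have E0 : nonempty E by exists (iv 0%N).1, 0%N.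
exists (sup E) => k; apply/eqP => fk.
have lo : (iv k.+1).1 <= sup E.
  by apply: ub_le_sup; [exists (iv 0%N).2; exact: ubE|exists k.+1].
have hi : sup E <= (iv k.+1).2 by apply: ge_sup => //; exact: ubE.
by apply: (step_out _ (f k) (iv_lt k)); rewrite -ivS fk lo hi.
Qed.

(** Otherwise every fibre of [d] is finite, and listing the fibres one after the
    other would enumerate the reals. *)
Lemma real_pigeonhole (d : R -> nat) : exists m, forall N,
  exists s : seq R, [/\ uniq s, (N <= size s)%N & forall x, x \in s -> d x = m].
Proof.
apply/not_existsP => H.
have cover m : exists s : seq R, forall x, d x = m -> x \in s.
  have /existsNP [N HN] := H m.
  apply/not_existsP => HC; apply: HN.
  elim: N => [|N [s [us Ns sm]]]; first by exists [::].
  have /existsNP [x /not_implyP [dx xs]] := HC s.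
  exists (x :: s); split=> //=; first by rewrite us andbT; apply/negP.
  by move=> y; rewrite inE => /orP[/eqP->|/sm].
have [l Hl] := choice cover.
pose f k := if unpickle k is Some (m, j) then nth 0 (l m) j else 0.
have [x Hx] := real_not_enumerable f.
have := Hx (pickle (d x, index x (l (d x)))).
by rewrite /f pickleK nth_index ?eqxx //; exact: Hl.
Qed.

Lemma complex_pigeonhole (d : R[i] -> nat) : exists m, forall N,
  exists s : seq R[i], [/\ uniq s, (N <= size s)%N & forall x, x \in s -> d x = m].
Proof.
have [m Hm] := real_pigeonhole (fun x => d (x%:C)%C).
exists m => N; have [s [us Ns sm]] := Hm N.
exists [seq (x%:C)%C | x <- s]; split; rewrite ?size_map //.
  by rewrite map_inj_uniq // => x y [].
by move=> _ /mapP [x xs ->]; exact: sm.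
Qed.
End Reals.

Section LinearDependence.
Variable K : fieldType.

Lemma dependent_rows (T U : finType) (f : T -> U -> K) : (#|U| < #|T|)%N ->
  exists2 c : T -> K, exists t, c t != 0 & forall u, \sum_t c t * f t u = 0.
Proof.
move=> ltUT; pose M := \matrix_(i < #|T|, j < #|U|) f (enum_val i) (enum_val j).
have : kermx M != 0.
  rewrite kermx_eq0 /row_free; apply: contraTneq ltUT => <-.
  by rewrite -leqNgt rank_leq_col.
case/rowV0Pn => w /sub_kermxP wM w0.
exists (fun t => w 0 (enum_rank t)).
  have [j wj] : exists j, w 0 j != 0.
    apply/existsP; apply: contra_neqT w0; rewrite negb_exists => /forallP H.
    by apply/rowP => j; rewrite mxE; have := H j; rewrite negbK => /eqP.
  by exists (enum_val j); rewrite enum_valK.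
move=> u; have := congr1 (fun B : 'M_(1, _) => B 0 (enum_rank u)) wM.
rewrite !mxE => E; rewrite -[RHS]E.
rewrite (reindex_onto (fun i : 'I_#|T| => enum_val i) enum_rank) /=; last first.
  by move=> t _; rewrite enum_rankK.
under eq_bigl do rewrite enum_valK eqxx.
by apply: eq_bigr => i _; rewrite !mxE enum_valK enum_rankK.
Qed.

(** Finite codimension of the subspace [P], phrased as: any family indexed by [T]
    is linearly dependent modulo [P].  This form passes to kernels and to finite
    intersections without constructing quotient spaces or bases. *)
Definition cofinite_by (V : lmodType K) (T : finType) (P : V -> Prop) :=
  forall x : T -> V, exists2 c : T -> K,
    exists t, c t != 0 & P (\sum_t c t *: x t).

Lemma cofinite_imp (V : lmodType K) T (P Q : V -> Prop) :
  (forall x, P x -> Q x) -> cofinite_by T P -> cofinite_by T Q.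
Proof. by move=> PQ HP x; have [c c0 /PQ] := HP x; exists c. Qed.

(** Split a family of #|U| * #|T| vectors into #|U| blocks; each block has a
    dependence modulo [P], and the #|U| resulting vectors of [P] have a dependence
    modulo [Q]. *)
Lemma cofinite_and (V : lmodType K) (T U : finType) (P Q : V -> Prop) :
  P 0 -> (forall c x y, P x -> P y -> P (c *: x + y)) ->
  cofinite_by T P -> cofinite_by U Q ->
  cofinite_by (U * T)%type (fun x => P x /\ Q x).
Proof.
move=> P0 PD HP HQ x.
have /choice [c Hc] : forall u, exists c : T -> K,
    (exists t, c t != 0) /\ P (\sum_t c t *: x (u, t)).
  by move=> u; have [c] := HP (fun t => x (u, t)); exists c.
have [d [u du] Hd] := HQ (fun u => \sum_t c u t *: x (u, t)).
exists (fun p => d p.1 * c p.1 p.2).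
  by have [[t ct] _] := Hc u; exists (u, t); rewrite mulf_neq0.
have -> : \sum_p (d p.1 * c p.1 p.2) *: x p =
    \sum_u d u *: \sum_t c u t *: x (u, t).
  under [RHS]eq_bigr do rewrite scaler_sumr.
  rewrite pair_bigA /=; apply: eq_bigr => -[u' t] _ /=.
  by rewrite scalerA.
split=> //; elim/big_ind: _ => [//|y z Py Pz|u' _].
  by rewrite -[y]scale1r; exact: PD.
by rewrite -[_ *: _]addr0; apply: PD => //; have [] := Hc u'.
Qed.

Lemma cofinite_all (V : lmodType K) (J : finType) (P : J -> V -> Prop) :
  (forall j, P j 0) -> (forall j c x y, P j x -> P j y -> P j (c *: x + y)) ->
  (forall j, exists T : finType, cofinite_by T (P j)) ->
  exists T : finType, cofinite_by T (fun x => forall j, P j x).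
Proof.
move=> P0 PD HP.
have [T HT] : exists T : finType,
    cofinite_by T (fun x => forall j, j \in enum J -> P j x).
  elim: (enum J) => [|j s [T HT]].
    exists unit => x; exists (fun _ => 1); first by exists tt; exact: oner_neq0.
    by [].
  have [U HU] := HP j.
  exists (T * U)%type.
  apply: cofinite_imp (cofinite_and (P0 j) (PD j) HU HT) => x [Hj Hs] i.
  by rewrite inE => /orP[/eqP->|/Hs].
by exists T; apply: cofinite_imp HT => x Hx j; apply: Hx; rewrite mem_enum.
Qed.

Lemma cofinite_ker (V W : lmodType K) (f : V -> W) m (s : 'I_m -> W) :
  linear f -> (forall x, exists c : 'I_m -> K, f x = \sum_i c i *: s i) ->
  cofinite_by 'I_m.+1 (fun x => f x = 0).
Proof.
move=> fl fs x; have [c Hc] := choice (fun t => fs (x t)).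
have [|g g0 Hg] := dependent_rows (T := 'I_m.+1) (U := 'I_m) c.
  by rewrite !card_ord.
exists g => //.
pose F := HB.pack_for {linear V -> W} f (GRing.isLinear.Build K V W *:%R f fl).
have -> : f (\sum_t g t *: x t) = \sum_t g t *: f (x t).
  rewrite -[f]/(F : V -> W) linear_sum; apply: eq_bigr => t _.
  by rewrite linearZ.
under eq_bigr do rewrite Hc scaler_sumr.
rewrite exchange_big big1 // => i _.
under eq_bigr do rewrite scalerA.
by rewrite -scaler_suml Hg scale0r.
Qed.
End LinearDependence.

(** * Ideals, characters and radical ideals of finite codimension *)

Section Ideals.
Variable A : comNzRingType.

Definition is_ideal (I : A -> Prop) : Prop :=
  [/\ I 0, forall a b, I a -> I b -> I (a + b) & forall a b, I b -> I (a * b)].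

Lemma is_idealN (I : A -> Prop) a : is_ideal I -> I a -> I (- a).
Proof. by case=> _ _ IM Ia; rewrite -mulN1r; exact: IM. Qed.

(** Zorn's lemma is applied to the sets [X] such that [I] together with [X] is a
    proper ideal: unlike the ideals above [I], these include the empty set, so
    that the empty chain needs no special treatment. *)
Lemma maximal_ideal (I : A -> Prop) : is_ideal I -> ~ I 1 ->
  exists M : A -> Prop, [/\ is_ideal M, ~ M 1, forall a, I a -> M a
    & forall a, ~ M a -> exists b, M (a * b - 1)].
Proof.
move=> idI I1; have [I0 ID IM] := idI.
pose P (X : set A) := is_ideal (fun a => I a \/ X a) /\ ~ X 1.
have [|X [[idX X1] maxX]] := @Zorn_bigcup A P.
  move=> F FP totF; split; last by case=> X FX X1; have [] := FP _ FX.
  split=> [|a b|a b]; first by left.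
    case=> [Ia|[X FX Xa]] [Ib|[Y FY Yb]].
    - by left; exact: ID.
    - have [[_ D _] _] := FP _ FY.
      by have [|] := D a b (or_introl Ia) (or_intror Yb); [left|right; exists Y].
    - have [[_ D _] _] := FP _ FX.
      by have [|] := D a b (or_intror Xa) (or_introl Ib); [left|right; exists X].
    have [XY|YX] := totF _ _ FX FY.
    - have [[_ D _] _] := FP _ FY.
      by have [|] := D a b (or_intror (XY _ Xa)) (or_intror Yb);
        [left|right; exists Y].
    have [[_ D _] _] := FP _ FX.
    by have [|] := D a b (or_intror Xa) (or_intror (YX _ Yb));
      [left|right; exists X].
  case=> [Ib|[X FX Xb]]; first by left; exact: IM.
  have [[_ _ M] _] := FP _ FX.
  by have [|] := M a b (or_intror Xb); [left|right; exists X].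
pose M a := I a \/ X a.
have [M0 MD MM] := idX.
exists M; split=> // [[]//|a Ia|a Ma]; first by left.
apply/not_existsP => Hb.
pose Y : set A := fun z => exists x y, M x /\ z = x + a * y.
have MY x : M x -> Y x by move=> Mx; exists x, 0; rewrite mulr0 addr0.
apply: (maxX Y); split.
- by move=> x Xx; apply: MY; right.
- by move=> YX; apply: Ma; right; apply: YX; exists 0, 1; rewrite mulr1 add0r.
- split=> [|x y|x y].
  + by left.
  + have YE z : I z \/ Y z -> Y z by case=> // Iz; apply: MY; left.
    move=> /YE [x0 [x1 [Mx ->]]] /YE [y0 [y1 [My ->]]]; right.
    by exists (x0 + y0), (x1 + y1); rewrite mulrDr addrACA; split=> //; exact: MD.
  + case=> [Iy|[y0 [y1 [My ->]]]]; first by left; exact: IM.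
    right; exists (x * y0), (x * y1).
    by rewrite mulrDr mulrCA; split=> //; exact: MM.
case=> x [y [Mx E]]; apply: (Hb y).
by rewrite E opprD addrCA subrr addr0; exact: is_idealN.
Qed.
End Ideals.

Section Characters.
Variables (K : closedFieldType) (A : comAlgType K).

Definition is_char (chi : A -> K) : Prop :=
  [/\ forall c a b, chi (c *: a + b) = c * chi a + chi b, chi 1 = 1
    & forall a b, chi (a * b) = chi a * chi b].

Section CharTheory.
Variables (chi : A -> K) (chiP : is_char chi).
Lemma char1 : chi 1 = 1. Proof. by case: chiP. Qed.
Lemma charM a b : chi (a * b) = chi a * chi b. Proof. by case: chiP. Qed.
Lemma charD a b : chi (a + b) = chi a + chi b.
Proof. by case: chiP => + _ _ => /(_ 1 a b); rewrite scale1r mul1r. Qed.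
Lemma char0 : chi 0 = 0.
Proof. by apply: (addrI (chi 0)); rewrite -charD !addr0. Qed.
Lemma charZ c a : chi (c *: a) = c * chi a.
Proof. by case: chiP => + _ _ => /(_ c a 0); rewrite !addr0 char0 addr0. Qed.
Lemma charN a : chi (- a) = - chi a.
Proof. by rewrite -scaleN1r charZ mulN1r. Qed.
Lemma charB a b : chi (a - b) = chi a - chi b.
Proof. by rewrite charD charN. Qed.
Lemma charX a k : chi (a ^+ k) = chi a ^+ k.
Proof. by elim: k => [|k IH]; rewrite ?char1 // !exprS charM IH. Qed.
Lemma char_prod (T : finType) (P : pred T) (f : T -> A) :
  chi (\prod_(t | P t) f t) = \prod_(t | P t) chi (f t).
Proof. exact: (big_morph chi charM char1). Qed.
Lemma char_sum (T : finType) (f : T -> A) :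
  chi (\sum_t f t) = \sum_t chi (f t).
Proof. exact: (big_morph chi charD char0). Qed.
End CharTheory.

Definition algebraic_mod (I : A -> Prop) (a : A) : Prop :=
  exists2 p : {poly K}, p != 0 & I (horner_alg a p).

Lemma ideal_scale (I : A -> Prop) c a : is_ideal I -> I a -> I (c *: a).
Proof. by case=> _ _ IM Ia; rewrite -[a]mul1r scalerAl; exact: IM. Qed.

(** Modulo a maximal ideal above [I] every element is a root of a polynomial,
    which splits; so every element is congruent to a scalar, and this scalar is
    the value of the character. *)
Lemma ideal_char (I : A -> Prop) : is_ideal I -> ~ I 1 ->
  (forall a, algebraic_mod I a) ->
  exists2 chi, is_char chi & forall a, I a -> chi a = 0.
Proof.
move=> idI I1 algI; have [M [idM M1 IM maxM]] := maximal_ideal idI I1.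
have [M0 MD MM] := idM.
have primeM a b : M (a * b) -> M a \/ M b.
  move=> Mab; have [?|/maxM [c Mc]] := pselect (M a); [by left|right].
  have -> : b = c * (a * b) + - b * (a * c - 1) by ring.
  by apply: MD; apply: MM.
have /choice [chi Hchi] a : exists c : K, M (a - c%:A).
  have [p p0 /IM Mp] := algI a.
  have [r Hr] := closed_field_poly_normal p.
  move: Mp; rewrite Hr -mul_polyC rmorphM /= horner_algC rmorph_prod.
  have lp0 : lead_coef p != 0 by rewrite lead_coef_eq0.
  case/primeM => [/(ideal_scale (lead_coef p)^-1 idM)|].
    by rewrite scalerA mulVf // scale1r.
  elim: r {Hr} => [|c r IH]; first by rewrite big_nil.
  rewrite big_cons => /primeM [|/IH//].
  by rewrite rmorphB /= horner_algX horner_algC; exists c.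
have uniq a c : M (a - c%:A) -> chi a = c.
  move=> Mc; apply/eqP; apply: contra_notT M1; rewrite -subr_eq0 => nz.
  have := MD _ _ Mc (is_idealN idM (Hchi a)).
  rewrite opprB addrC addrA subrK -scalerBl.
  move/(ideal_scale (chi a - c)^-1 idM).
  by rewrite scalerA mulVf // scale1r.
exists chi; last by move=> a /IM Ma; apply: uniq; rewrite scale0r subr0.
split=> [c a b||a b]; apply: uniq.
- have -> : c *: a + b - (c * chi a + chi b)%:A =
      c *: (a - (chi a)%:A) + (b - (chi b)%:A).
    by rewrite scalerDl -scalerA scalerBr opprD addrACA.
  by apply: MD => //; exact: ideal_scale.
- by rewrite scale1r subrr.
have -> : a * b - (chi a * chi b)%:A =
    b * (a - (chi a)%:A) + (chi a)%:A * (b - (chi b)%:A).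
  rewrite -scalerA -[chi b *: 1]mul1r scalerAl.
  ring.
by apply: MD; exact: MM.
Qed.

Lemma dependent_algebraic (I : A -> Prop) (T : finType) a :
  cofinite_by T I -> algebraic_mod I a.
Proof.
move=> HI; have [c [t ct] Hc] := HI (fun t => a ^+ enum_rank t).
exists (\poly_(i < #|T|) oapp (fun j : 'I_#|T| => c (enum_val j)) 0 (insub i)).
  apply/eqP => /(congr1 (fun p : {poly K} => p`_(enum_rank t))).
  rewrite coef_poly ltn_ord valK /= enum_rankK coef0 => /eqP.
  by rewrite (negPf ct).
rewrite poly_def rmorph_sum /=; move: Hc; congr I.
rewrite (reindex_onto (fun i : 'I_#|T| => enum_val i) enum_rank) /=; last first.
  by move=> u _; rewrite enum_rankK.
under eq_bigl do rewrite enum_valK eqxx.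
apply: eq_bigr => i _; rewrite enum_valK valK /=.
by rewrite linearZ /= rmorphXn /= horner_algX mulr_algl.
Qed.

(** Lagrange interpolation: the element attached to [t] is the product over
    [s != t] of elements at which [chi t] is 1 and [chi s] is 0. *)
Lemma separating_elements (T : finType) (chi : T -> A -> K) :
  (forall t, is_char (chi t)) ->
  (forall s t, s != t -> exists a, chi s a <> chi t a) ->
  exists e : T -> A, forall s t, chi s (e t) = (s == t)%:R.
Proof.
move=> chiP dist.
have /choice [b Hb] (p : T * T) : exists b : A, p.2 != p.1 ->
    chi p.1 b = 1 /\ chi p.2 b = 0.
  have [->|/dist [a /eqP]] := eqVneq p.2 p.1; first by exists 0.
  rewrite eq_sym -subr_eq0 => nz.
  exists ((chi p.1 a - chi p.2 a)^-1 *: (a - (chi p.2 a)%:A)) => _.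
  have c0 t c : chi t c%:A = c by rewrite charZ // char1 // mulr1.
  by rewrite !charZ // !charB // !c0 subrr mulr0 mulVf.
exists (fun t => \prod_(s | s != t) b (t, s)) => s t.
rewrite char_prod //; have [->|st] := eqVneq s t.
  by apply: big1 => u ut; have [] := Hb (t, u) ut.
by rewrite (bigD1 s) //=; have [_ ->] := Hb (t, s) st; rewrite mul0r.
Qed.

Lemma card_chars (I : A -> Prop) (U : finType) (T : finType)
    (chi : T -> A -> K) : cofinite_by U I ->
  (forall t, is_char (chi t)) -> (forall t a, I a -> chi t a = 0) ->
  (forall s t, s != t -> exists a, chi s a <> chi t a) -> (#|T| < #|U|)%N.
Proof.
move=> HI chiP chiI dist; rewrite ltnNge; apply/negP => leUT.
have [e He] := separating_elements chiP dist.
pose g (u : U) : T := enum_val (widen_ord leUT (enum_rank u)).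
have g_inj : injective g.
  by move=> u w /enum_val_inj /(congr1 val) /= /val_inj /enum_rank_inj.
have [c [u cu] Ic] := HI (fun u => e (g u)).
have := chiI (g u) _ Ic; rewrite char_sum // (bigD1 u) //= big1 => [|w wu].
  by rewrite addr0 charZ // He eqxx mulr1 => /eqP; rewrite (negPf cu).
by rewrite charZ // He (inj_eq g_inj) eq_sym (negPf wu) mulr0.
Qed.

(** Write a polynomial relation of [a] modulo [I] as a^k (c + a q) in [I] with
    c <> 0.  Since [I] is radical, a (c + a q) is in [I], so the ideal [J] generated
    by [I] and c + a q is proper; a character vanishing on [J] sends a q to -c. *)
Lemma radical_char (I : A -> Prop) a : is_ideal I ->
  (forall b k, I (b ^+ k.+1) -> I b) -> (forall b, algebraic_mod I b) ->
  ~ I a -> exists chi, [/\ is_char chi, forall b, I b -> chi b = 0 & chi a <> 0].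
Proof.
move=> idI radI algI Ia; have [I0 ID IM] := idI.
have [p p0 Ip] := algI a.
have [q [c [c0 Iq]]] : exists q c, c != 0 /\ I (a * (c%:A + a * q)).
  have [k [q q0 Ep]] := multiplicity_XsubC p 0.
  rewrite p0 /= in q0; rewrite Ep subr0 rmorphM rmorphXn /= horner_algX in Ip.
    have Eq : q = (q.[0])%:P + 'X * ((q - (q.[0])%:P) %/ 'X).
    have : root (q - (q.[0])%:P) 0 by rewrite /root hornerD hornerN hornerC subrr.
    rewrite root_factor_theorem subr0 => /divpK E.
    by rewrite mulrC E addrC subrK.
  exists (horner_alg a ((q - (q.[0])%:P) %/ 'X)), (q.[0]); split.
    by rewrite -/(root q 0).
  have -> : (q.[0])%:A + a * horner_alg a ((q - (q.[0])%:P) %/ 'X) = horner_alg a q.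
    by rewrite [in RHS]Eq rmorphD rmorphM /= horner_algX horner_algC.
  apply: (radI _ k).
  rewrite exprMn exprS [_ ^+ k.+1]exprSr.
  have -> : a * a ^+ k * (horner_alg a q ^+ k * horner_alg a q) =
    (a * horner_alg a q ^+ k) * (horner_alg a q * a ^+ k) by ring.
  exact: IM.
set w := c%:A + a * q in Iq.
pose J x := exists y z, I y /\ x = y + w * z.
have IJ x : I x -> J x by move=> Ix; exists x, 0; rewrite mulr0 addr0.
have [|J1||chi chiP chiJ] := ideal_char (I := J).
- split=> [|x y|x y].
  + exact: IJ.
  + case=> x0 [x1 [Ix ->]] [y0 [y1 [Iy ->]]].
    by exists (x0 + y0), (x1 + y1); rewrite mulrDr addrACA; split=> //; exact: ID.
  + case=> y0 [y1 [Iy ->]]; exists (x * y0), (x * y1).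
    by rewrite mulrDr mulrCA; split=> //; exact: IM.
- case: J1 => y [z [Iy E]]; apply: Ia.
  have -> : a = a * y + z * (a * w).
    by rewrite -[LHS]mulr1 E; ring.
  by apply: ID; exact: IM.
- by move=> b; have [r r0 Ir] := algI b; exists r => //; exact: IJ.
exists chi; split=> // [b Ib|a0]; first exact/chiJ/IJ.
have /chiJ : J w by exists 0, 1; rewrite add0r mulr1.
rewrite charD // charM // a0 mul0r addr0 charZ // char1 // mulr1 => /eqP.
by rewrite (negPf c0).
Qed.

(** The number of distinct characters vanishing on [I] is bounded by the
    codimension; a maximal family of them separates [I] by [radical_char]. *)
Lemma radical_family (I : A -> Prop) (U : finType) : is_ideal I ->
  (forall b k, I (b ^+ k.+1) -> I b) -> cofinite_by U I ->
  exists k (chi : 'I_k -> A -> K), [/\ forall i, is_char (chi i),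
    forall i j, i != j -> exists a, chi i a <> chi j a
    & forall a, (forall i, chi i a = 0) -> I a].
Proof.
move=> idI radI HI.
have algI a : algebraic_mod I a by exact: dependent_algebraic HI.
pose fam k := exists chi : 'I_k -> A -> K, [/\ forall i, is_char (chi i),
    forall i a, I a -> chi i a = 0
    & forall i j, i != j -> exists a, chi i a <> chi j a].
have ex : exists k, `[< fam k >].
  by exists 0%N; apply/asboolP; exists (fun _ _ => 0); split=> -[].
have bd k : `[< fam k >] -> (k <= #|U|)%N.
  case/asboolP=> chi [H1 H2 H3]; rewrite -(card_ord k) ltnW //.
  exact: card_chars HI H1 H2 H3.
case: (ex_maxnP ex bd) => k /asboolP [chi [H1 H2 H3]] maxk.
exists k, chi; split=> // a a0.
apply: contrapT => Ia.
have [x [Hx Ix xa]] := radical_char idI radI algI Ia.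
suff : `[< fam k.+1 >] by move/maxk; rewrite ltnn.
apply/asboolP; exists (fun j => if unlift ord0 j is Some i then chi i else x).
split=> [j|j b Ib|j l].
- by case: unlift.
- by case: unlift => [i|]; [exact: H2|exact: Ix].
case: (unliftP ord0 j) => [i ->|->]; case: (unliftP ord0 l) => [m ->|->] //.
- by rewrite (inj_eq lift_inj); exact: H3.
- by move=> _; exists a; rewrite a0 => /esym.
- by move=> _; exists a; rewrite a0.
Qed.
End Characters.

(** * The weak Nullstellensatz over an uncountable field *)

Section Nullstellensatz.

Lemma span_countable (K : fieldType) (V : lmodType K) (X : countType)
    (w : X -> V) v : v \in span_of (fun y => exists x, y = w x) ->
  exists m (c : 'I_m -> K),
    v = \sum_(i < m) c i *: oapp w 0 (unpickle i).
Proof.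
pose g k := oapp w 0 (unpickle k : option X).
pose Q v := exists m (c : nat -> K), v = \sum_(i < m) c i *: g i.
have pad m (c : nat -> K) d : exists c' : nat -> K,
    \sum_(i < m) c i *: g i = \sum_(i < m + d) c' i *: g i.
  exists (fun i => if (i < m)%N then c i else 0).
  rewrite big_split_ord /= [X in _ = _ + X]big1 ?addr0 => [|i _].
    by apply: eq_bigr => i _; rewrite ltn_ord.
  by rewrite ltnNge leq_addr scale0r.
move=> Hv; suff [m [c ->]] : Q v by exists m, (fun i => c i).
move: v Hv; apply: span_ind => [|c x y [m [cx ->]] [l [cy ->]]|_ [x ->]].
- by exists 0%N, (fun=> 0); rewrite big_ord0.
- have [c1 ->] := pad m cx l; have [c2 ->] := pad l cy m.
  exists (m + l)%N, (fun i => c * c1 i + c2 i).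
  rewrite [in X in _ + X]addnC scaler_sumr -big_split; apply: eq_bigr => i _ /=.
  by rewrite scalerDl scalerA.
exists (pickle x).+1, (fun i => (i == pickle x)%:R).
rewrite big_ord_recr /= eqxx scale1r big1 ?add0r => [|i _].
  by rewrite /g pickleK.
by rewrite ltn_eqF ?scale0r.
Qed.

Lemma fg_countably_spanned (K : fieldType) (A : comAlgType K) :
  finitely_generated A ->
  exists g : nat -> A, forall a, exists m (c : 'I_m -> K),
    a = \sum_(i < m) c i *: g i.
Proof.
case=> s Hs; pose X := seq (seq_sub s); pose w (x : X) : A := \prod_(y <- x) val y.
exists (fun k => oapp w 0 (unpickle k)) => a; apply: span_countable.
apply: Hs => [|x xs]; last first.
  by apply: mem_span; exists [:: SeqSub xs]; rewrite /w big_seq1.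
split=> [||x y].
- by apply: mem_span; exists [::]; rewrite /w big_nil.
- by move=> c x y Hx Hy; rewrite rpredD ?rpredZ.
move=> Hx Hy; move: x Hx; apply: span_ind => [|c x x' Hx Hx'|_ [x ->]].
- by rewrite mul0r rpred0.
- by rewrite mulrDl -scalerAl rpredD ?rpredZ.
move: y Hy; apply: span_ind => [|c y y' Hy Hy'|_ [y ->]].
- by rewrite mulr0 rpred0.
- by rewrite mulrDr -scalerAr rpredD ?rpredZ.
by apply: mem_span; exists (x ++ y); rewrite /w big_cat.
Qed.

(** Let [a] be congruent to no scalar modulo the maximal ideal [M], and let [b c]
    be an inverse of a - c modulo [M].  The first [m] elements of a countable
    spanning family contain, for a suitable [m], infinitely many [b c] in their
    span; clearing denominators in a linear relation between m + 1 of them gives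
    a polynomial relation for [a]. *)
Lemma weak_nullstellensatz (K : closedFieldType) (A : comAlgType K) :
  (forall d : K -> nat, exists m, forall N, exists s : seq K,
     [/\ uniq s, (N <= size s)%N & forall x, x \in s -> d x = m]) ->
  finitely_generated A -> exists chi : A -> K, is_char chi.
Proof.
move=> pigeonhole /fg_countably_spanned [g Hg].
have [||M [idM M1 _ maxM]] := @maximal_ideal A (fun a => a = 0).
- by split=> // [a b -> ->|a b ->]; rewrite ?addr0 ?mulr0.
- by apply/eqP; rewrite oner_eq0.
have [M0 MD MM] := idM.
have [a|chi chiP _] := ideal_char idM M1; last by exists chi.
have [[c Mc]|/forallNP nM] := pselect (exists c, M (a - c%:A)).
  exists ('X - c%:P); first by rewrite polyXsubC_eq0.
  by rewrite rmorphB /= horner_algX horner_algC.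
have [b Hb] := choice (fun c => maxM _ (nM c)).
have [d Hd] := choice (fun c => Hg (b c)).
have [m Hm] := pigeonhole d; have [s [us ms sd]] := Hm m.+1.
pose T := 'I_m.+1; pose z (t : T) := s`_t.
have z_inj (t l : T) : (z t == z l) = (t == l).
  by rewrite nth_uniq ?(leq_trans _ ms).
have dz t : d (z t) = m by apply/sd/mem_nth/leq_trans/ms.
have /choice [f Hf] t : exists f : 'I_m -> K, b (z t) = \sum_i f i *: g i.
  by have := Hd (z t); rewrite dz.
have [|c [t0 ct0] Hc] := dependent_rows f; first by rewrite !card_ord.
pose q (t : T) : {poly K} := \prod_(l | l != t) ('X - (z l)%:P).
exists (\sum_t c t *: q t).
  apply/eqP => /(congr1 (horner^~ (z t0))).
  rewrite horner0 horner_sum (bigD1 t0) //= big1 => [|t nt]; last first.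
    by rewrite hornerZ horner_prod (bigD1 t0) 1?eq_sym //= hornerXsubC subrr mul0r mulr0.
  move/eqP; rewrite addr0 hornerZ mulf_eq0 (negPf ct0) horner_prod /=.
  apply/negP/prodf_neq0 => l lt; rewrite !hornerE subr_eq0 z_inj eq_sym.
  exact: lt.
pose Pi := \prod_t (a - (z t)%:A).
have Z : Pi * \sum_t c t *: b (z t) = 0.
  rewrite (_ : \sum_t _ = 0) ?mulr0 //.
  under eq_bigr do rewrite Hf scaler_sumr.
  rewrite exchange_big big1 // => i _; under eq_bigr do rewrite scalerA.
  by rewrite -scaler_suml Hc scale0r.
rewrite -[X in M X]subr0 -Z mulr_sumr linear_sum -sumrB.
elim/big_ind: _ => // t _; pose r := horner_alg a (q t).
have -> : Pi = (a - (z t)%:A) * r.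
  rewrite /Pi (bigD1 t) //= /r /q rmorph_prod; congr (_ * _).
  by apply: eq_bigr => l _; rewrite rmorphB /= horner_algX horner_algC.
rewrite linearZ -scalerAr /= mulr_algl -scalerBr; apply: ideal_scale => //.
have -> : r - (a - (z t)%:A) * r * b (z t) = - r * ((a - (z t)%:A) * b (z t) - 1).
  ring.
exact: MM.
Qed.
End Nullstellensatz.

(** * Irreducible modules described by Chevalley generators *)

Section LinearFun.
Variables (K : fieldType) (V W : lmodType K) (f : V -> W).
Hypothesis fl : linear f.
Let bl : forall x : V, linear ((fun _ : V => f) x). Proof. by []. Qed.
Lemma lfD x y : f (x + y) = f x + f y.
Proof. exact: (bilDr bl 0). Qed.
Lemma lf0 : f 0 = 0.
Proof. exact: (bil0r bl 0). Qed.
Lemma lfZ c x : f (c *: x) = c *: f x.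
Proof. exact: (bilZr bl c 0). Qed.
Lemma lfN x : f (- x) = - f x.
Proof. exact: (bilNr bl 0). Qed.
Lemma lfB x y : f (x - y) = f x - f y.
Proof. by rewrite lfD lfN. Qed.
End LinearFun.

(** Only the Chevalley generators enter the arguments about V, so they are carried
    out for abstract operators: [E i a], [F i a] stand for e_i ⊗ a, f_i ⊗ a, and
    the commuting operators [X c] for the elements of (h' ⊗ A) ⊕ h''.  An index [c]
    has a root value [wt c j] in A, so that the commutator of X c with F j b is
    - F j (wt c j * b); for h ⊗ a it is alpha_j(h) a, and for an element of h'' it
    is a scalar.  The index [co i a] stands for the coroot h_i ⊗ a, [q] for the Cartan
    matrix, and [D] for an element of the Cartan subalgebra on which all simple
    roots take the value 1, so that eigenvalues of [X D] record the depth below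
    the highest weight. *)
Section ChevalleyModule.
Variables (K : numFieldType) (n : nat) (A : comAlgType K) (G : Type).
Variables (V : lmodType K) (E F : 'I_n -> A -> V -> V) (X : G -> V -> V).
Variables (wt : G -> 'I_n -> A) (co : 'I_n -> A -> G) (q : 'I_n -> 'I_n -> K).
Hypothesis E_linear : forall i a, linear (E i a).
Hypothesis F_linear : forall i a, linear (F i a).
Hypothesis X_linear : forall c, linear (X c).
Hypothesis F_linear_coef : forall i u, linear (F i ^~ u).
Hypothesis XX : forall c d u, X c (X d u) = X d (X c u).
Hypothesis XE : forall c j b u, X c (E j b u) = E j b (X c u) + E j (wt c j * b) u.
Hypothesis XF : forall c j b u, X c (F j b u) = F j b (X c u) - F j (wt c j * b) u.
Hypothesis EF : forall i j a b u,
  E i a (F j b u) = F j b (E i a u) + (if i == j then X (co i (a * b)) u else 0).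
Hypothesis wt_co : forall i j a, wt (co i a) j = q i j *: a.
Hypothesis q_diag : forall i, q i i = 2.
Variable D : G.
Hypothesis wt_D : forall j, wt D j = 1.

Section LoweringWords.
Variable T : V -> Prop.

(** [lowered m] is the span of the words of length [m] in the operators [F i a]
    applied to vectors of [T].  The closure under [lowered_zero] makes each degree
    a subspace even when it contains no word. *)
Inductive lowered : nat -> V -> Prop :=
| lowered_base t : T t -> lowered 0 t
| lowered_F m i a u : lowered m u -> lowered m.+1 (F i a u)
| lowered_lin m c x y : lowered m x -> lowered m y -> lowered m (c *: x + y)
| lowered_zero m : lowered m 0.

Lemma loweredD m x y : lowered m x -> lowered m y -> lowered m (x + y).
Proof. by move=> Hx Hy; rewrite -[x]scale1r; exact: lowered_lin. Qed.

Lemma loweredN m x : lowered m x -> lowered m (- x).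
Proof.
move=> Hx; rewrite -scaleN1r -[_ *: _]addr0.
by apply: lowered_lin => //; exact: lowered_zero.
Qed.

Hypothesis TX : forall c t, T t -> T (X c t).
Hypothesis TE : forall i a t, T t -> E i a t = 0.

Lemma lowered_X c m u : lowered m u -> lowered m (X c u).
Proof.
elim=> {m u} [t Tt|m i a u Hu IH|m d x y _ Hx _ Hy|m].
- exact/lowered_base/TX.
- by rewrite XF; apply: loweredD; [|apply: loweredN]; exact: lowered_F.
- by rewrite X_linear; exact: lowered_lin.
- by rewrite lf0 //; exact: lowered_zero.
Qed.

(** Moving [E i a] to the right through a word produces Cartan operators, which
    preserve degree, until it reaches a vector of [T] and kills it. *)
Lemma lowered_E i a m u : lowered m u ->
  if m is m'.+1 then lowered m' (E i a u) else E i a u = 0.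
Proof.
elim=> {m u} [t|m j b u Hu IH|m d x y _ Hx _ Hy|m].
- exact: TE.
- rewrite EF; apply: loweredD.
    case: m Hu IH => [|m] _ IH; last exact: lowered_F.
    by rewrite IH lf0 //; exact: lowered_zero.
  by case: ifP => _; [exact: lowered_X|exact: lowered_zero].
- rewrite E_linear; case: m Hx Hy => [-> ->|m Hx Hy].
    by rewrite scaler0 addr0.
  exact: lowered_lin.
- by rewrite lf0 //; case: m => // m; exact: lowered_zero.
Qed.

Lemma lowered_D d m u : (forall t, T t -> X D t = d *: t) ->
  lowered m u -> X D u = (d - m%:R) *: u.
Proof.
move=> TD; elim=> {m u} [t Tt|m i a u Hu IH|m c x y _ Hx _ Hy|m].
- by rewrite subr0 TD.
- by rewrite XF IH wt_D mul1r lfZ // -[X in _ - X]scale1r -scalerBl -natr1 opprD addrA.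
- by rewrite X_linear Hx Hy scalerDr !scalerA mulrC.
- by rewrite lf0 // scaler0.
Qed.

Definition lowering_span : submodClosed V := span_of (fun u => exists m, lowered m u).

(** The part of the Poincare-Birkhoff-Witt theorem that is needed: the lowering
    operators alone generate the submodule spanned by [T]. *)
Lemma lowering_span_stable :
  [/\ forall i a u, u \in lowering_span -> E i a u \in lowering_span,
      forall i a u, u \in lowering_span -> F i a u \in lowering_span
    & forall c u, u \in lowering_span -> X c u \in lowering_span].
Proof.
have st f : linear f ->
    (forall m u, lowered m u -> f u \in lowering_span) ->
    forall u, u \in lowering_span -> f u \in lowering_span.
  move=> fl Hf; apply: span_ind => [|c x y Hx Hy|u [m Hu]].
  - by rewrite lf0 // rpred0.
  - by rewrite fl rpredD ?rpredZ.
  exact: Hf Hu.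
split=> [i a|i a|c]; apply: st => // m u Hu.
- case: m Hu => [|m] /(lowered_E i a) Hu; first by rewrite Hu rpred0.
  by apply: mem_span; exists m.
- by apply: mem_span; exists m.+1; exact: lowered_F.
by apply: mem_span; exists m; exact: lowered_X.
Qed.
End LoweringWords.

Variable v : V.
Hypothesis v_neq0 : v <> 0.
Hypothesis Ev : forall i a, E i a v = 0.
Hypothesis Xv : forall c, exists k : K, X c v = k *: v.
Hypothesis irr : forall S : submodClosed V,
  (forall i a u, u \in S -> E i a u \in S) ->
  (forall i a u, u \in S -> F i a u \in S) ->
  (forall c u, u \in S -> X c u \in S) ->
  (forall u, u \in S -> u = 0) \/ (forall u, u \in S).

Variable d0 : K.
Hypothesis Dv : X D v = d0 *: v.

(** The product of the operators X D - (d0 - l) for 1 <= l <= M.  It annihilates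
    every vector of depth between 1 and M, but multiplies [v], of depth 0, by M!. *)
Fixpoint kill_degrees M u :=
  if M is M.+1 then X D (kill_degrees M u) - (d0 - M.+1%:R) *: kill_degrees M u
  else u.

Lemma kill_degrees_linear M : linear (kill_degrees M).
Proof.
elim: M => [//|M IH] c x y /=; rewrite !IH X_linear scalerBr !scalerDr opprD.
by rewrite !scalerA (mulrC c) addrACA.
Qed.

Lemma kill_degrees_eigen M l u : X D u = (d0 - l%:R) *: u ->
  kill_degrees M u = (\prod_(j < M) (j.+1%:R - l%:R)) *: u.
Proof.
move=> Du; elim: M => [|M IH] /=; first by rewrite big_ord0 scale1r.
rewrite IH lfZ // Du big_ord_recr /= !scalerA -scalerBl.
by congr (_ *: _); ring.
Qed.

(** The vectors killed by all [E i a] at the depth of [w] form a set stable under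
    the Cartan operators; the submodule that they generate lives at depth at least
    m + 1, so it does not contain [v] and must vanish. *)
Lemma singular_vector m w : X D w = (d0 - m.+1%:R) *: w ->
  (forall i a, E i a w = 0) -> w = 0.
Proof.
move=> Dw Ew; pose T t := X D t = (d0 - m.+1%:R) *: t /\ forall i a, E i a t = 0.
have TX c t : T t -> T (X c t).
  case=> Dt Et; split=> [|i a]; first by rewrite XX Dt lfZ.
  by have := XE c i a t; rewrite !Et lf0 // addr0 => <-.
have TE i a t : T t -> E i a t = 0 by case.
have [SE SF SX] := lowering_span_stable TX TE.
have [S0|ST] := irr SE SF SX.
  by apply: S0; apply: mem_span; exists 0%N; exact: lowered_base.
suff [M HM] : exists M0, forall M, (M0 <= M)%N -> kill_degrees M v = 0.
  case: v_neq0; apply/eqP; have /eqP := HM M (leqnn M).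
  rewrite (@kill_degrees_eigen _ 0) ?subr0 // scaler_eq0 => /orP[|//].
  move/prodf_eq0 => [j _]; by rewrite subr0 pnatr_eq0.
move: v (ST v); apply: span_ind => [|c x y [Mx Hx] [My Hy]|u [l Hu]].
- by exists 0%N => M _; rewrite lf0 //; exact: kill_degrees_linear.
- exists (maxn Mx My) => M; rewrite geq_max => /andP[/Hx Ex /Hy Ey].
  by rewrite kill_degrees_linear Ex Ey scaler0 addr0.
exists (m.+1 + l)%N => M lM.
rewrite (@kill_degrees_eigen _ (m.+1 + l)); last first.
  rewrite (@lowered_D T (d0 - m.+1%:R) l) // => [|t []//].
  by rewrite natrD opprD addrA.
have ltM : (m + l < M)%N by [].
by rewrite (bigD1 (Ordinal ltM)) //= addSn subrr mul0r scale0r.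
Qed.

Let line t := exists k : K, t = k *: v.

Lemma generated_by_v u : u \in lowering_span line.
Proof.
have TX c t : line t -> line (X c t).
  by case=> k ->; have [l Hl] := Xv c; exists (k * l); rewrite lfZ // Hl scalerA.
have TE i a t : line t -> E i a t = 0 by case=> k ->; rewrite lfZ // Ev scaler0.
have [SE SF SX] := lowering_span_stable TX TE.
have [S0|//] := irr SE SF SX.
case: v_neq0; apply: S0; apply: mem_span; exists 0%N.
by apply: lowered_base; exists 1; rewrite scale1r.
Qed.

Definition vanishing (a : A) : Prop := forall i, F i a v = 0.

(** Applying h_i ⊗ a to (f_i ⊗ b) v gives -2 (f_i ⊗ a b) v up to a multiple of
    (f_i ⊗ b) v. *)
Lemma vanishing_ideal : is_ideal vanishing.
Proof.
split=> [i|a b Ia Ib i|a b Ib i].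
- exact: (lf0 (F_linear_coef i v)).
- by rewrite (lfD (F_linear_coef i v)) Ia Ib addr0.
have [k Hk] := Xv (co i a).
have := XF (co i a) i b v.
rewrite Hk Ib lfZ // Ib lf0 // scaler0 sub0r wt_co q_diag -scalerAl.
rewrite (lfZ (F_linear_coef i v)) => /esym/eqP.
by rewrite oppr_eq0 scaler_eq0 pnatr_eq0 /= => /eqP.
Qed.

(** Induction on the length of the word [u].  The Cartan operator passes through
    [u] at the cost of replacing some [F k b] by [F k (a * b)], which vanishes on
    the rest of the word by induction.  Hence every [E i c] kills [F j a u], and
    this vector has positive depth. *)
Lemma vanishing_lowered m u a : lowered line m u -> vanishing a ->
  forall j, F j a u = 0 /\ X (co j a) u = 0.
Proof.
have [_ _ IM] := vanishing_ideal.
have TX c t : line t -> line (X c t).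
  by case=> k ->; have [l Hl] := Xv c; exists (k * l); rewrite lfZ // Hl scalerA.
have TE i b t : line t -> E i b t = 0 by case=> k ->; rewrite lfZ // Ev scaler0.
elim: m u a => [|m IH] u a Hu Ia j.
  have Xu b : vanishing b -> forall i, X (co i b) v = 0.
    move=> Ib i; have := EF i i 1 b v.
    by rewrite Ib lf0 // Ev lf0 // add0r eqxx mul1r.
  have [k ->] : line u.
    move: Hu; move E0 : 0%N => l Hu; elim: Hu E0 => // [l' c x y _ Hx _ Hy E0|l' _].
      have [[k ->] [k' ->]] := (Hx E0, Hy E0).
      by exists (c * k + k'); rewrite scalerDl scalerA.
    by exists 0; rewrite scale0r.
  by rewrite !lfZ // Ia Xu // scaler0.
have XH b i : vanishing b -> X (co i b) u = 0.
  move=> Ib; move: Hu; move E0 : m.+1 => l Hu.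
  elim: Hu E0 => // [l' k c w Hw _ [El]|l' c x y _ Hx _ Hy E0|l' _].
  - rewrite XF; rewrite -El in Hw; have [_ ->] := IH _ _ Hw Ib i.
    rewrite lf0 // wt_co -scalerAl (lfZ (F_linear_coef _ _)) mulrC.
    by have [-> _] := IH _ _ Hw (IM c _ Ib) k; rewrite scaler0 subr0.
  - by rewrite X_linear Hx // Hy // scaler0 addr0.
  by rewrite lf0.
split; last exact: XH.
apply: (@singular_vector m.+1).
  have Dl t : line t -> X D t = d0 *: t by case=> k ->; rewrite lfZ // Dv !scalerA mulrC.
  exact: (lowered_D Dl (lowered_F j a Hu)).
move=> i c; rewrite EF.
have [-> _] := IH _ _ (lowered_E TX TE i c Hu) Ia j; rewrite add0r.
by case: ifP => // _; apply: XH; exact: IM.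
Qed.

Lemma vanishing_acts0 a j u : vanishing a -> E j a u = 0 /\ F j a u = 0.
Proof.
move=> Ia; have [_ _ IM] := vanishing_ideal.
move: u (generated_by_v u); apply: span_ind => [|c x y [Ex Fx] [Ey Fy]|u [m Hu]].
- by rewrite !lf0.
- by rewrite E_linear F_linear Ex Ey Fx Fy scaler0 addr0.
split; last by have [] := vanishing_lowered Hu Ia j.
elim: Hu => {m u} [t [k ->]|m i b u Hu IH|m c x y _ Hx _ Hy|m].
- by rewrite lfZ // Ev scaler0.
- rewrite EF IH lf0 // add0r; case: ifP => // _.
  by have [] := vanishing_lowered Hu (IM b _ Ia) j; rewrite mulrC.
- by rewrite E_linear Hx Hy scaler0 addr0.
by rewrite lf0.
Qed.

Hypothesis F_nilpotent : forall i a u, exists k, iter k (F i a) u = 0.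

(** The computation in sl_2: [Ew] below is the familiar action of e on the
    powers of f, without its quadratic term because b^2 acts as zero. *)
Lemma vanishing_sqr b : vanishing (b * b) -> vanishing b.
Proof.
move=> Ibb i; have [_ _ IM] := vanishing_ideal.
pose f := F i b; pose w k := iter k f v.
have Xf c u : X (co i (c * b)) (f u) = f (X (co i (c * b)) u).
  rewrite XF wt_co -scalerAl -mulrA (lfZ (F_linear_coef _ _)).
  by have [_ ->] := vanishing_acts0 i u (IM c _ Ibb); rewrite scaler0 subr0.
have /choice [mu Hmu] c : exists k, X (co i (c * b)) v = k *: v by exact: Xv.
have Xw c k : X (co i (c * b)) (w k) = mu c *: w k.
  by elim: k => [|k IH] //=; rewrite Xf IH /f lfZ.
have Ew c k : E i c (w k.+1) = (k.+1%:R * mu c) *: w k.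
  elim: k => [|k IH]; first by rewrite /w /= EF Ev lf0 // add0r eqxx mul1r.
  rewrite [w k.+2]/(f (w k.+1)) EF IH lfZ // eqxx Xw -scalerDl.
  by rewrite -[in RHS]natr1 mulrDl mul1r.
have mu0 c : mu c = 0.
  (* At the least power of F i b that kills v, [Ew] reads 0 = k mu_c w_(k-1). *)
  have ex : exists k, w k == 0 by have [k Hk] := F_nilpotent i b v; exists k; apply/eqP.
  case: (ex_minnP ex) => -[|k] /eqP wk mink; first by case: v_neq0.
  have := Ew c k; rewrite wk lf0 // => /esym/eqP.
  rewrite scaler_eq0 mulf_eq0 pnatr_eq0 /= => /orP[/eqP//|/mink].
  by rewrite ltnn.
apply: (@singular_vector 0); first by rewrite XF Dv wt_D mul1r lfZ // scalerBl scale1r.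
move=> j c; rewrite EF Ev lf0 // add0r; case: eqP => // ->.
by rewrite Hmu mu0 scale0r.
Qed.

Lemma vanishing_radical b k : vanishing (b ^+ k.+1) -> vanishing b.
Proof.
have [_ _ IM] := vanishing_ideal => Ibk.
have : vanishing (b ^+ (2 ^ k.+1)).
  have lek : (k.+1 <= 2 ^ k.+1)%N by rewrite ltnW // ltn_expl.
  by rewrite -(subnK lek) exprD; exact: IM.
elim: k.+1 => [//|m IH]; rewrite expnS mul2n -addnn exprD.
by move/vanishing_sqr.
Qed.

Lemma vanishing_spec : [/\ is_ideal vanishing,
  forall b k, vanishing (b ^+ k.+1) -> vanishing b
  & forall a, vanishing a -> forall j u, E j a u = 0 /\ F j a u = 0].
Proof.
split; [exact: vanishing_ideal|exact: vanishing_radical|].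
by move=> a Ia j u; exact: vanishing_acts0.
Qed.
End ChevalleyModule.

(** * Chevalley generators of the derived Kac-Moody algebra *)

Section ChevalleyGenerators.
Variables (K : numFieldType) (n : nat) (C : 'M[int]_n) (C_gcm : gcm C).
Variables (h : vectType K) (rl : realization C h).
Local Notation g := (km rl).

Definition km_e i : g := qlpi (@km_rad K n C h rl) (lie_gen (km_rel rl) (kE h i)).
Definition km_f i : g := qlpi (@km_rad K n C h rl) (lie_gen (km_rel rl) (kF h i)).

Lemma km_he x i : bracket (km_h rl x) (km_e i) = (Defs.root rl i x : K) *: km_e i.
Proof.
rewrite /km_h /km_e -qlpi_lie -qlpiZ; congr qlpi.
rewrite /tilde_h /lie_gen /pgen lie_pres_bracket -ppi_scale.
by apply/ppiP/pc_rel/lr_rel; constructor.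
Qed.

Lemma km_hf x i : bracket (km_h rl x) (km_f i) = - (Defs.root rl i x : K) *: km_f i.
Proof.
rewrite /km_h /km_f -qlpi_lie -qlpiZ; congr qlpi.
rewrite /tilde_h /lie_gen /pgen lie_pres_bracket -ppi_scale.
by apply/ppiP/pc_rel/lr_rel; constructor.
Qed.

Lemma km_ef i : bracket (km_e i) (km_f i) = km_h rl (coroot rl i).
Proof.
rewrite /km_h /km_f /km_e -qlpi_lie; congr qlpi.
rewrite /tilde_h /lie_gen /pgen lie_pres_bracket.
by apply/ppiP/pc_rel/lr_rel; constructor.
Qed.

Lemma km_ef0 i j : i != j -> bracket (km_e i) (km_f j) = 0.
Proof.
move=> ij; rewrite /km_f /km_e -qlpi_lie -[RHS](_ : qlpi (@km_rad K n C h rl) 0 = 0) //.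
congr qlpi.
rewrite /lie_gen /pgen lie_pres_bracket -ppi0.
by apply/ppiP/pc_rel/lr_rel; constructor.
Qed.

Inductive generated : g -> Prop :=
| generated_e i : generated (km_e i)
| generated_f i : generated (km_f i)
| generated_0 : generated 0
| generated_lin c x y : generated x -> generated y -> generated (c *: x + y)
| generated_bracket x y : generated x -> generated y -> generated (bracket x y).

Lemma generatedD x y : generated x -> generated y -> generated (x + y).
Proof. by move=> Hx Hy; rewrite -[x]scale1r; exact: generated_lin. Qed.
Lemma generatedZ c x : generated x -> generated (c *: x).
Proof. by move=> Hx; rewrite -[_ *: _]addr0; apply: generated_lin => //; exact: generated_0. Qed.
Lemma generatedN x : generated x -> generated (- x).
Proof. by rewrite -scaleN1r; exact: generatedZ. Qed.

Lemma generated_ad_h y x : generated x -> generated (bracket (km_h rl y) x).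
Proof.
elim=> {x} [i|i||c x x' _ Hx _ Hx'|x x' Cx Hx Cx' Hx'].
- by rewrite km_he; apply/generatedZ/generated_e.
- by rewrite km_hf; apply/generatedZ/generated_f.
- by rewrite bracket0r; exact: generated_0.
- by rewrite bracketDr bracketZr; exact: generated_lin.
by rewrite bracket_leibniz; apply: generatedD; exact: generated_bracket.
Qed.

(** The Kac-Moody algebra is the sum of h and [generated], because [generated] is
    stable under ad h and h is abelian; consequently all brackets lie in [generated]. *)
Lemma km_h_generated (x : g) : exists y z, generated z /\ x = km_h rl y + z.
Proof.
have hD y y' : km_h rl (y + y') = km_h rl y + km_h rl y'.
  by rewrite (lfD (km_h_linear rl)).
rewrite -[x]qlpi_repr; move: (repr x) => {x} t.
have e0 : generated 0 by exact: generated_0.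
move: t; apply: pres_ind => [[y|i|i]||p q [y [z [Cz Ez]]] [y' [z' [Cz' Ez']]]
    |c p [y [z [Cz Ez]]]|[] p q [y [z [Cz Ez]]] [y' [z' [Cz' Ez']]]].
- by exists y, 0; rewrite addr0.
- by exists 0, (km_e i); split; [exact: generated_e|rewrite km_h0 add0r].
- by exists 0, (km_f i); split; [exact: generated_f|rewrite km_h0 add0r].
- by exists 0, 0; rewrite km_h0 addr0.
- exists (y + y'), (z + z'); split; first exact: generatedD.
  by rewrite qlpiD Ez Ez' hD addrACA.
- exists (c *: y), (c *: z); split; first exact: generatedZ.
  by rewrite qlpiZ Ez scalerDr (lfZ (km_h_linear rl)).
exists 0, (bracket (km_h rl y) z' - bracket (km_h rl y') z + bracket z z'); split.
  by apply: generatedD; [apply: generatedD; [|apply: generatedN]; exact: generated_ad_h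
    |exact: generated_bracket].
rewrite -[pop tt p q]/(bracket (p : km_tilde rl) q) qlpi_lie Ez Ez' km_h0 add0r.
by rewrite bracketDl !bracketDr km_hh add0r (bracketC z (km_h _ _)) addrA.
Qed.

Lemma derived_generated (x : g) : x \in derived g -> generated x.
Proof.
move: x; apply: span_ind => [|c x y|_ [x [y ->]]].
- exact: generated_0.
- exact: generated_lin.
have [a [z [Cz ->]]] := km_h_generated x; have [b [w [Cw ->]]] := km_h_generated y.
rewrite bracketDl !bracketDr km_hh add0r (bracketC z (km_h _ _)).
apply: generatedD; first exact: generated_ad_h.
by apply: generatedD; [apply/generatedN/generated_ad_h|exact: generated_bracket].
Qed.

Lemma root_coroot_diag i : Defs.root rl i (coroot rl i) = 2 :> K.
Proof. by rewrite root_coroot; have [-> _ _] := C_gcm. Qed.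

Lemma two_neq0 : 2 != 0 :> K. Proof. by rewrite pnatr_eq0. Qed.

Lemma km_e_derived i : km_e i \in derived g.
Proof.
rewrite -[km_e i]scale1r -(mulVf two_neq0) -scalerA rpredZ //.
by rewrite -(root_coroot_diag i) -km_he; exact: derived_bracket.
Qed.

Lemma km_f_derived i : km_f i \in derived g.
Proof.
rewrite -[km_f i]scale1r -(mulVf two_neq0) -scalerA rpredZ //.
have -> : 2 *: km_f i = - bracket (km_h rl (coroot rl i)) (km_f i).
  by rewrite km_hf root_coroot_diag scaleNr opprK.
by rewrite -scaleN1r rpredZ // derived_bracket.
Qed.

Definition kmp_e i : kmp rl := SubOf (km_e_derived i).
Definition kmp_f i : kmp rl := SubOf (km_f_derived i).

Lemma coroot_hp i : coroot rl i \in km_hp rl.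
Proof.
rewrite -[_ \in _]/(km_h rl (coroot rl i) \in derived g) -km_ef.
exact: derived_bracket.
Qed.

Definition coroot_p i : sub_of (km_hp rl) := SubOf (coroot_hp i).

(** Since every bracket lies in [generated], g' is generated by the e_i and f_i. *)
Lemma kmp_ind (P : kmp rl -> Prop) :
  (forall i, P (kmp_e i)) -> (forall i, P (kmp_f i)) -> P 0 ->
  (forall c x y, P x -> P y -> P (c *: x + y)) ->
  (forall x y, P x -> P y -> P (bracket x y)) -> forall x, P x.
Proof.
move=> Pe Pf P0 PD PB x.
suff H y : generated y -> y \in derived g /\ forall z : kmp rl, val z = y -> P z.
  by have [_] := H _ (derived_generated (valP x)); exact.
elim=> {x y} [i|i||c x y _ [dx Px] _ [dy Py]|x y _ [dx Px] _ [dy Py]].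
- by split=> [|z Ez]; [exact: km_e_derived|rewrite (_ : z = kmp_e i) //; exact: val_inj].
- by split=> [|z Ez]; [exact: km_f_derived|rewrite (_ : z = kmp_f i) //; exact: val_inj].
- by split=> [|z Ez]; [rewrite rpred0|rewrite (_ : z = 0) //; exact: val_inj].
- split=> [|z Ez]; first by rewrite rpredD ?rpredZ.
  rewrite (_ : z = c *: (SubOf dx : kmp rl) + (SubOf dy : kmp rl)).
    by apply: PD; [exact: Px|exact: Py].
  by apply: val_inj.
split=> [|z Ez]; first exact: derived_bracket.
rewrite (_ : z = bracket (SubOf dx : kmp rl) (SubOf dy : kmp rl)).
  by apply: PB; [exact: Px|exact: Py].
by apply: val_inj.
Qed.

(** The simple roots are linearly independent, so they take any prescribed values
    at some point of h. *)
Lemma exists_rho : exists x : h, forall i, Defs.root rl i x = 1 :> K.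
Proof.
pose M := \matrix_(k < \dim {:h}, i < n) (Defs.root rl i (vbasis {:h})`_k : K).
have rM : \rank M = n.
  apply/eqP; rewrite eqn_leq rank_leq_col /= -mxrank_tr.
  rewrite leqNgt; apply/negP => lt.
  have : kermx M^T != 0.
    by rewrite kermx_eq0 /row_free neq_ltn lt.
  case/rowV0Pn => w /sub_kermxP wM /negP; apply.
  have := root_free rl.
  have -> : codom (Defs.root rl) = [tuple Defs.root rl i | i < n].
    by rewrite /= codomE enumT.
  move/freeP => /(_ (w 0)) H; apply/eqP/rowP => i; rewrite mxE; apply: H.
  apply/lfunP => x; rewrite [in RHS]lfunE /= sum_lfunE.
  rewrite (coord_vbasis (memvf x)).
  rewrite (eq_bigr (fun j => w 0 j *: \sum_k coord (vbasis {:h}) k x *: (M k j : K^o))); last first.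
    move=> j _; rewrite (nth_map j) ?size_enum_ord // nth_ord_enum scale_lfunE.
    congr (_ *: _); rewrite linear_sum; apply: eq_bigr => k _.
    by rewrite linearZ mxE.
  under eq_bigr do rewrite scaler_sumr.
  rewrite exchange_big big1 // => k _ /=.
  have := congr1 (fun B : 'M_(1, _) => B 0 k) wM.
  rewrite !mxE => E.
  rewrite (eq_bigr (fun j => coord (vbasis {:h}) k x *: (w 0 j * M^T j k : K^o))).
    by rewrite -scaler_sumr E scaler0.
  by move=> j _; rewrite [M^T j k]mxE; exact: mulrCA.
have /row_fullP [B BM] : row_full M by rewrite /row_full rM.
pose u : 'rV[K]_n := const_mx 1.
exists (\sum_k (u *m B) 0 k *: (vbasis {:h})`_k) => i.
rewrite linear_sum /=.
have := congr1 (fun N : 'M_(1, _) => N 0 i) (congr1 (mulmx u) BM).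
rewrite mulmx1 mulmxA !mxE => <-.
by apply: eq_bigr => k _; rewrite linearZ [M k i]mxE.
Qed.
End ChevalleyGenerators.

(** * The current algebra and its highest weight modules *)

Section CurrentAlgebra.
Variables (K : fieldType) (n : nat) (C : 'M[int]_n).
Variables (h : vectType K) (rl : realization C h) (h2 : submodClosed h).
Variables (A : comAlgType K).

Lemma ckm_bracket_g (x y : kmp rl) (a b : A) :
  bracket (ckm_g h2 x a) (ckm_g h2 y b) = ckm_g h2 (bracket x y) (a * b).
Proof.
rewrite [LHS]semidir_bracketE !(bil0l (der_linl (cur_action A (h2_action rl h2)))) subr0 addr0.
by rewrite cur_bracketE.
Qed.

Lemma ckm_g_linear_coef (x : kmp rl) : linear (fun a : A => ckm_g h2 x a).
Proof. by move=> c a b; rewrite /ckm_g tpure_linr; congr pair; rewrite /= scaler0 addr0. Qed.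
Lemma ckm_g_linear (a : A) : linear (fun x : kmp rl => ckm_g h2 x a).
Proof. by move=> c x y; rewrite /ckm_g tpure_linl; congr pair; rewrite /= scaler0 addr0. Qed.

Lemma act_linear_coef (V : lmodType K) (act : lie_mod (ckm rl h2 A) V) x u :
  linear (fun a : A => act (ckm_g h2 x a) u).
Proof. by move=> c a b; rewrite ckm_g_linear_coef lact_linl. Qed.
End CurrentAlgebra.

Section CurrentModule.
Variables (K : numFieldType) (n : nat) (C : 'M[int]_n) (C_gcm : gcm C).
Variables (h : vectType K) (rl : realization C h) (h2 : submodClosed h).
Variables (A : comAlgType K).
Local Notation gA := (ckm rl h2 A).

(** The triple (x, a, y) indexes the element x ⊗ a + y of (h' ⊗ A) ⊕ h''.  This
    single family contains the coroots h_i ⊗ a, the subspace h'', and the copy of h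
    whose eigenspaces are the weight spaces (for a = 1). *)
Definition cartan_index : Type := (sub_of (km_hp rl) * A * sub_of h2)%type.
Definition cartan_elt (c : cartan_index) : gA := (hp_incl c.1.1 ⊗ c.1.2, c.2).
Definition cartan_wt (c : cartan_index) (j : 'I_n) : A :=
  (Defs.root rl j (val c.1.1) : K) *: c.1.2 + (Defs.root rl j (val c.2) : K) *: 1.
Definition coroot_index i (a : A) : cartan_index := (coroot_p rl i, a, 0).

(** The cases [s = 1] and [s = -1] are the brackets with e_j ⊗ b and f_j ⊗ b. *)
Lemma cartan_bracket (c : cartan_index) (j : 'I_n) (s : K) (z : kmp rl) b :
  (forall y, bracket (km_h rl y) (val z) = (s * Defs.root rl j y) *: val z) ->
  bracket (cartan_elt c) (ckm_g h2 z b) = s *: ckm_g h2 z (cartan_wt c j * b).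
Proof.
case: c => [[x a] y] Hz; rewrite [LHS]semidir_bracketE.
rewrite (bil0l (der_linl (cur_action A (h2_action rl h2)))) subr0.
rewrite cur_actionE cur_bracketE.
have -> : bracket (hp_incl x) z = (s * Defs.root rl j (val x)) *: z.
  by apply: val_inj; rewrite /= Hz.
have -> : h2_action rl h2 y z = (s * Defs.root rl j (val y)) *: z.
  by apply: val_inj; rewrite /= Hz.
rewrite !(bilZl (@tpure_linl _ _ _)) -!scalerA -scalerDr.
congr pair; last by rewrite scaler0.
congr (_ *: _); rewrite /cartan_wt /= mulrDl -!scalerAl mul1r.
by rewrite (bilDr (@tpure_linr _ _ _)) !(bilZr (@tpure_linr _ _ _)).
Qed.

Lemma cartan_comm (c d : cartan_index) : bracket (cartan_elt c) (cartan_elt d) = 0.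
Proof.
have z0 (x : kmp rl) a : val x = 0 -> (x ⊗ a : current _ A) = 0.
  by move=> x0; rewrite (_ : x = 0) ?(bil0l (@tpure_linl _ _ _)) //; exact: val_inj.
case: c d => [[x a] y] [[x' a'] y']; rewrite [LHS]semidir_bracketE.
rewrite !cur_actionE cur_bracketE !z0 ?subr0 ?addr0 //; exact: km_hh.
Qed.

Variables (V : lmodType K) (act : lie_mod gA V).
Local Notation E i a := (act (ckm_g h2 (kmp_e C_gcm rl i) a)).
Local Notation F i a := (act (ckm_g h2 (kmp_f C_gcm rl i) a)).
Local Notation X c := (act (cartan_elt c)).

Lemma act_commutator p p' u : act p (act p' u) = act p' (act p u) + act (bracket p p') u.
Proof. by rewrite lact_bracket addrC subrK. Qed.

Lemma act_XE c j b u : X c (E j b u) = E j b (X c u) + E j (cartan_wt c j * b) u.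
Proof.
rewrite act_commutator (@cartan_bracket c j 1) ?scale1r // => y.
by rewrite km_he mul1r.
Qed.

Lemma act_XF c j b u : X c (F j b u) = F j b (X c u) - F j (cartan_wt c j * b) u.
Proof.
rewrite act_commutator (@cartan_bracket c j (-1)) => [|y].
  by rewrite (lfZ (lact_linl act u)) scaleN1r.
by rewrite km_hf mulN1r.
Qed.

Lemma act_EF i j a b u : E i a (F j b u) =
  F j b (E i a u) + (if i == j then X (coroot_index i (a * b)) u else 0).
Proof.
rewrite act_commutator ckm_bracket_g; congr (_ + _); case: eqVneq => [->|ij].
  congr (act (_, _) u); congr (_ ⊗ _).
  by apply: val_inj; rewrite /= km_ef.
have -> : bracket (kmp_e C_gcm rl i) (kmp_f C_gcm rl j) = 0.
  by apply: val_inj; rewrite /= km_ef0.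
by rewrite (lf0 (ckm_g_linear _ _)) (lf0 (lact_linl act u)).
Qed.

Lemma coroot_index_wt i j a : cartan_wt (coroot_index i a) j = (C i j)%:~R *: a.
Proof. by rewrite /cartan_wt /= linear0 scale0r addr0 root_coroot. Qed.

Lemma act_from_generators (S : submodClosed V) :
  (forall i a u, u \in S -> E i a u \in S) ->
  (forall i a u, u \in S -> F i a u \in S) ->
  (forall c u, u \in S -> X c u \in S) -> submodule act S.
Proof.
move=> SE SF SX [t y] u Su.
have -> : (t, y) = (t, 0) + (0, y) :> gA by congr pair; rewrite /= ?addr0 ?add0r.
rewrite (lfD (lact_linl act u)) rpredD //; last first.
  have := SX (0, 0, y) u Su.
  by rewrite /cartan_elt /= (bil0r (@tpure_linr _ _ _)).
have tl : linear (fun t : current (kmp rl) A => (t, 0) : gA).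
  by move=> c p p'; congr pair; rewrite /= scaler0 addr0.
move: t; apply: tens_ind => [x a||s t Hs Ht|c t Ht].
- rewrite -/(ckm_g h2 x a); move: x a u Su; apply: (@kmp_ind _ _ _ C_gcm).
  + exact: SE.
  + exact: SF.
  + by move=> a u Su; rewrite (lf0 (ckm_g_linear _ _)) (lf0 (lact_linl act u)) rpred0.
  + move=> c x x' Hx Hx' a u Su.
    by rewrite ckm_g_linear lact_linl rpredD ?rpredZ ?Hx ?Hx'.
  move=> x y' Hx Hy a u Su.
  rewrite -[a]mulr1 -ckm_bracket_g lact_bracket -scaleN1r.
  by rewrite rpredD ?rpredZ //; [apply/Hx/Hy|apply/Hy/Hx].
- by rewrite (lf0 tl) (lf0 (lact_linl act u)) rpred0.
- by rewrite (lfD tl) (lfD (lact_linl act u)) rpredD.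
by rewrite (lfZ tl) (lfZ (lact_linl act u)) rpredZ.
Qed.

(** The elements x of g' such that x ⊗ a acts as zero for all [a] in [I] are closed
    under bracket with any y, since [x, y] ⊗ a = [x ⊗ a, y ⊗ 1]. *)
Lemma kmp_acts0 (I : A -> Prop) :
  (forall a, I a -> forall i u, E i a u = 0 /\ F i a u = 0) ->
  forall x a u, I a -> act (ckm_g h2 x a) u = 0.
Proof.
move=> HI; apply: (@kmp_ind _ _ _ C_gcm).
- by move=> i a u /HI /(_ i u) [].
- by move=> i a u /HI /(_ i u) [].
- by move=> a u _; rewrite (lf0 (ckm_g_linear _ _)) (lf0 (lact_linl act u)).
- by move=> c x y Hx Hy a u Ia; rewrite ckm_g_linear lact_linl Hx // Hy // scaler0 addr0.
move=> x y Hx _ a u Ia; rewrite -[a]mulr1 -ckm_bracket_g lact_bracket !Hx //.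
by rewrite (lf0 (lact_linr act _)) subrr.
Qed.
End CurrentModule.

Section HighestWeight.
Variables (K : fieldType) (n : nat) (C : 'M[int]_n).
Variables (h : vectType K) (rl : realization C h) (h2 : submodClosed h).
Variables (A : comAlgType K) (psi : {linear cartan_cur rl h2 A -> K^o}).
Variables (V : lmodType K) (act : lie_mod (ckm rl h2 A) V).
Hypothesis V_psi : is_Vpsi psi act.

Lemma borel_nplus (x : kmp rl) (a : A) :
  val x \in (km_nplus (rl:=rl)) -> ckm_g h2 x a \in (borel (rl:=rl) (h2:=h2) (Q:=A)).
Proof. by move=> Hx; apply: mem_span; constructor 1; exists x, a. Qed.

Lemma borel_cartan (x : sub_of (km_hp rl)) (a : A) (y : sub_of h2) :
  ((hp_incl x ⊗ a, y) : ckm rl h2 A) \in (borel (rl:=rl) (h2:=h2) (Q:=A)).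
Proof.
have mg : ckm_g h2 (hp_incl x) a \in (borel (rl:=rl) (h2:=h2) (Q:=A)).
  by apply: mem_span; apply: Or32; exists x, a.
have mh : ckm_h2 rl A y \in (borel (rl:=rl) (h2:=h2) (Q:=A)).
  by apply: mem_span; apply: Or33; exists y.
have -> : (hp_incl x ⊗ a, y) = ckm_g h2 (hp_incl x) a + ckm_h2 rl A y :> ckm rl h2 A.
  by congr pair; rewrite /= ?addr0 ?add0r.
exact: rpredD mg mh.
Qed.

(** The vector is the image of the generator 1 ⊗ 1 of M(psi).  It is nonzero because
    it generates V: the elements of U(g_A) that map it to 0 form a left ideal, so
    if it were 0 then the image of M(psi) would be 0. *)
Lemma highest_weight_vector : exists2 v : V, v <> 0 &
  (forall x a, val x \in (km_nplus (rl:=rl)) -> act (ckm_g h2 x a) v = 0) /\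
  (forall x a y, exists k : K, act (hp_incl x ⊗ a, y) v = k *: v).
Proof.
have [[[w w0] _] [c [[cN cH] [pi [[pil pih] pis]]]]] := V_psi.
pose v := pi (ind_pure c 1 1).
have Bv (b : sublie (borel (rl:=rl) (h2:=h2) (Q:=A))) : act (val b) v = (c b 1 : K) *: v.
  rewrite /v -pih /= ind_act_pure mulr1.
  have -> : env_gen (val b) = 1 * env_incl (env_gen b).
    rewrite mul1r /env_incl plift_gen //.
    - by move=> o u x y z; rewrite mulrDl scalerAl.
    - by move=> o u x y z; rewrite mulrDr scalerAr.
    move=> t u [d x y|x y|s t' u'|t'|t'] //=; first exact: env_gen_linear.
    - by rewrite scaleN1r; exact: env_gen_bracket.
    - exact: mulrA.
    - exact: mul1r.
    - exact: mulr1.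
  rewrite ind_pure_bal env_act_gen -[X in ind_pure c 1 X]mulr1.
  rewrite -[(c b 1 : K) * 1]/((c b 1 : K) *: (1 : K^o)).
  by rewrite (bilZr (@ind_pure_linr _ _ _ _ _)) (lfZ pil).
exists v.
  move=> v0; apply: w0; have [u <-] := pis w.
  (* The accumulator s' makes the induction over products of generators go
     through. *)
  have gen (s : env (ckm rl h2 A)) : forall s', pi (ind_pure c s' 1) = 0 ->
      pi (ind_pure c (s * s') 1) = 0.
    move: s; apply: pres_ind => [[x|]||s t Hs Ht|d s Hs|[] s t Hs Ht] s' Hs'.
    - by rewrite -(ind_act_pure c x s' 1) pih Hs' (lf0 (lact_linr act x)).
    - by rewrite (mul1r s').
    - by rewrite mul0r (bil0l (@ind_pure_linl _ _ _ _ _)) (lf0 pil).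
    - rewrite mulrDl (bilDl (@ind_pure_linl _ _ _ _ _)) (lfD pil) Hs // Ht //.
      by rewrite addr0.
    - rewrite -scalerAl (bilZl (@ind_pure_linl _ _ _ _ _)) (lfZ pil) Hs //.
      by rewrite scaler0.
    by rewrite -[pop tt s t]/((s : env _) * t) -mulrA; apply/Hs/Ht.
  move: u; apply: induced_ind => [s z||s t Hs Ht|d t Ht].
  - rewrite -[z]mulr1 -[z * 1]/(z *: (1 : K^o)).
    rewrite (bilZr (@ind_pure_linr _ _ _ _ _)) (lfZ pil) -[s]mulr1 gen //.
    by rewrite scaler0.
  - exact: lf0 pil.
  - by rewrite (lfD pil) Hs Ht addr0.
  - by rewrite (lfZ pil) Ht scaler0.
split=> [x a Hx|x a y].
  have := Bv (SubOf (borel_nplus a Hx)); rewrite /= => ->.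
  by rewrite (cN x a _ Hx) // scale0r.
have Bex p : p \in (borel (rl:=rl) (h2:=h2) (Q:=A)) ->
    exists k : K, act p v = k *: v.
  by move=> Hp; exists (c (SubOf Hp) 1); exact: (Bv (SubOf Hp)).
exact/Bex/borel_cartan.
Qed.
End HighestWeight.

(** * Factoring the action through copies of the derived algebra *)

Lemma lie_mod_factor (K : fieldType) (L M : lieAlgType K) (V : lmodType K)
    (act : lie_mod L V) (f : L -> M) (w : M -> V -> V) :
  lie_hom f -> (forall q, exists p, f p = q) ->
  (forall p v, act p v = w (f p) v) ->
  exists W : lie_mod M V, forall p v, act p v = W (f p) v.
Proof.
move=> [fl fb] fs fw.
have wl v : linear (w ^~ v).
  move=> c x y; have [p <-] := fs x; have [r <-] := fs y.
  by rewrite -fl -!fw lact_linl.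
have wr x : linear (w x).
  by have [p <-] := fs x; move=> c u v; rewrite -!fw lact_linr.
have wb x y v : w (bracket x y) v = w x (w y v) - w y (w x v).
  have [p <-] := fs x; have [r <-] := fs y.
  by rewrite -fb -!fw lact_bracket.
by exists (LieMod wl wr wb).
Qed.

Section SemidirectHom.
Variables (K : fieldType) (H : lmodType K) (L M : lieAlgType K).
Variables (A : comAlgType K) (d : der_action H L) (d' : der_action H M).
Variable f : L -> A -> M.
Hypothesis fl : forall a, linear (f ^~ a).
Hypothesis fr : forall x, linear (f x).
Hypothesis fB : forall x y a b, bracket (f x a) (f y b) = f (bracket x y) (a * b).
Hypothesis fd : forall z x a, d' z (f x a) = f (d z x) a.

(** Both the reduction of A modulo an ideal and the splitting into copies are maps
    of semidirect products induced by a bilinear map on L x A. *)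
Lemma semidir_lift_hom : lie_hom
  (fun p : semidir (cur_action A d) => (tlift f p.1, p.2) : semidir d').
Proof.
have tl : linear (tlift f) by exact: tlift_linear fl fr.
have t0 := lf0 tl; have tD := lfD tl; have tZ := lfZ tl.
have tB s t : tlift f (bracket (s : current L A) t) = bracket (tlift f s) (tlift f t).
  move: s t; apply: tens_ind => [x a|t|s s' Hs Hs' t|c s Hs t].
  - apply: tens_ind => [y b||t t' Ht Ht'|c t Ht].
    + by rewrite cur_bracketE !tlift_pure // fB.
    + by rewrite !bracket0r t0 bracket0r.
    + by rewrite bracketDr !tD bracketDr Ht Ht'.
    + by rewrite bracketZr !tZ bracketZr Ht.
  - by rewrite !bracket0l t0 bracket0l.
  - by rewrite bracketDl !tD bracketDl Hs Hs'.
  - by rewrite bracketZl !tZ bracketZl Hs.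
have td z t : tlift f (cur_action A d z t) = d' z (tlift f t).
  move: t; apply: tens_ind => [x a||s t Hs Ht|c t Ht].
  - by rewrite cur_actionE !tlift_pure // fd.
  - by rewrite t0 !(lf0 (der_linr _ _)) t0.
  - by rewrite tD !(lfD (der_linr _ _)) tD Hs Ht.
  - by rewrite tZ !(lfZ (der_linr _ _)) tZ Ht.
split=> [c p q|[s y] [t z]].
  by congr pair; rewrite /= tl.
rewrite !semidir_bracketE; congr pair.
by rewrite /= -[tlift f _]/(tlift f _) (lfB tl) tD tB !td.
Qed.
End SemidirectHom.

Section Evaluation.
Variables (K : closedFieldType) (n : nat) (C : 'M[int]_n).
Variables (h : vectType K) (rl : realization C h) (h2 : submodClosed h).
Variables (A : comAlgType K) (J : idealr A).
Local Notation Q := {ideal_quot J}.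

Lemma pi_eq (a b : A) : a - b \in J -> \pi_Q a = \pi_Q b.
Proof. by move=> Jab; apply/eqP; rewrite -Quotient.idealrBE. Qed.

Lemma repr_pi (a : A) : repr (\pi_Q a) - a \in J.
Proof. by rewrite Quotient.idealrBE reprK. Qed.

Lemma pi_linear : linear (fun a : A => \pi_Q a).
Proof. by move=> c a b; rewrite -pi_scaleE -rmorphD. Qed.

Lemma ckm_proj_hom : lie_hom (@ckm_proj K n C h rl h2 A J).
Proof.
apply: semidir_lift_hom => [a c x y|x c a b|x y a b|z x a].
- exact: tpure_linl.
- by rewrite pi_linear tpure_linr.
- by rewrite cur_bracketE rmorphM.
exact: cur_actionE.
Qed.

Lemma ckm_proj_g (x : kmp rl) (a : A) y :
  ckm_proj J ((x ⊗ a, y) : ckm rl h2 A) = (x ⊗ \pi_Q a, y).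
Proof.
rewrite /ckm_proj tlift_pure // => [b|z] c u w; first exact: tpure_linl.
by rewrite pi_linear tpure_linr.
Qed.

Lemma ckm_proj_surj (q : ckm rl h2 Q) : exists p, ckm_proj J p = q.
Proof.
case: q => t y.
have pl : linear (fun s => (ckm_proj J ((s, 0) : ckm rl h2 A)).1).
  move=> c s t'; rewrite -[RHS]/(c *: ckm_proj J ((s, 0) : ckm rl h2 A)
    + ckm_proj J ((t', 0) : ckm rl h2 A)).1 -(proj1 ckm_proj_hom).
  by congr (ckm_proj J (_, _)).1; rewrite /= scaler0 addr0.
suff [s Hs] : exists s, (ckm_proj J ((s, 0) : ckm rl h2 A)).1 = t.
  by exists (s, y); rewrite -Hs.
move: t; apply: tens_ind => [x a||s t [s' <-] [t' <-]|c t [t' <-]].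
- by exists (x ⊗ repr a); rewrite ckm_proj_g reprK.
- by exists 0; rewrite (lf0 pl).
- by exists (s' + t'); rewrite (lfD pl).
- by exists (c *: t'); rewrite (lfZ pl).
Qed.

Section Factor.
Variables (V : lmodType K) (act : lie_mod (ckm rl h2 A) V).
Hypothesis J_acts0 : forall x a v, a \in J -> act (ckm_g h2 x a) v = 0.

(** The action of x ⊗ q is defined through a representative of q; it is bilinear
    because two representatives differ by an element that acts as zero. *)
Lemma act_factors_proj : exists w : ckm rl h2 Q -> V -> V,
  forall p v, act p v = w (ckm_proj J p) v.
Proof.
pose f v (x : kmp rl) (a : Q) := act (ckm_g h2 x (repr a)) v.
have fE v x (a : A) : f v x (\pi_Q a) = act (ckm_g h2 x a) v.
  apply/eqP; rewrite -subr_eq0 /f -(lfB (act_linear_coef act x v)).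
  by rewrite J_acts0 ?repr_pi.
have fl v a : linear (f v ^~ a).
  by move=> c x y; rewrite /f ckm_g_linear lact_linl.
have fr v x : linear (f v x).
  move=> c a b; rewrite -[a]reprK -[b]reprK -pi_linear !fE.
  exact: act_linear_coef.
exists (fun q v => tlift (f v) q.1 + act (0, q.2) v) => -[t y] v /=.
have -> : (t, y) = (t, 0) + (0, y) :> ckm rl h2 A by congr pair; rewrite /= ?addr0 ?add0r.
rewrite (lfD (lact_linl act v)); congr (_ + _).
have tl : linear (fun t : current (kmp rl) A => (t, 0) : ckm rl h2 A).
  by move=> c p p'; congr pair; rewrite /= scaler0 addr0.
have pil : linear (tlift (fun x a => x ⊗ \pi_Q a : current (kmp rl) Q)).
  apply: tlift_linear => [a|x] c u w; first exact: tpure_linl.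
  by rewrite pi_linear tpure_linr.
apply: (@tens_ext _ _ _ _ (fun t => act (t, 0) v)
  (fun t => tlift (f v) (tlift (fun x a => x ⊗ \pi_Q a : current (kmp rl) Q) t))).
- by move=> c s s'; rewrite tl lact_linl.
- by move=> c s s'; rewrite pil (tlift_linear (fl v) (fr v)).
move=> x a; rewrite -[tlift _ (x ⊗ a)]/(ckm_proj J ((x ⊗ a, 0) : ckm rl h2 A)).1.
by rewrite ckm_proj_g tlift_pure.
Qed.
End Factor.

Variables (k : nat) (chi : 'I_k -> A -> K).
Hypothesis chiP : forall i, is_char (chi i).
Hypothesis chi_dist : forall i j, i != j -> exists a, chi i a <> chi j a.
Hypothesis J_ker : forall a, a \in J <-> forall i, chi i a = 0.

Definition evaluation (q : Q) : {ffun 'I_k -> K^o} := [ffun i => chi i (repr q) : K^o].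

Lemma evaluation_pi a i : evaluation (\pi_Q a) i = chi i a.
Proof.
rewrite ffunE; apply/eqP; rewrite -subr_eq0 -(charB (chiP i)).
by apply/eqP; move: i; apply/J_ker/repr_pi.
Qed.

Lemma evaluation_iso : alg_iso evaluation.
Proof.
have [e He] := separating_elements chiP chi_dist.
split.
- move=> c a b; rewrite -[a]reprK -[b]reprK -pi_linear; apply/ffunP => i.
  have lin (f f' : {ffun 'I_k -> K^o}) : (c *: f + f') i = c * f i + f' i.
    by rewrite !ffunE.
  by rewrite lin !evaluation_pi (charD (chiP i)) (charZ (chiP i)).
- rewrite -[1](rmorph1 \pi_Q); apply/ffunP => i.
  by rewrite evaluation_pi (char1 (chiP i)) ffunE.
- move=> a b; rewrite -[a]reprK -[b]reprK -rmorphM; apply/ffunP => i.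
  have mul (f f' : {ffun 'I_k -> K^o}) : (f * f') i = f i * f' i by rewrite ffunE.
  by rewrite mul !evaluation_pi (charM (chiP i)).
have chi_lift f i : chi i (\sum_j (f j : K) *: e j) = f i.
  rewrite (char_sum (chiP i)) (bigD1 i) //= big1 => [|j ji].
    by rewrite (charZ (chiP i)) He eqxx mulr1 addr0.
  by rewrite (charZ (chiP i)) He eq_sym (negPf ji) mulr0.
exists (fun f : {ffun 'I_k -> K^o} => \pi_Q (\sum_i (f i : K) *: e i)) => [a|f]; last first.
  by apply/ffunP => i; rewrite evaluation_pi chi_lift.
rewrite -[RHS]reprK; apply: pi_eq; apply/J_ker => i.
by rewrite (charB (chiP i)) chi_lift ffunE subrr.
Qed.

Definition split_copies (p : ckm rl h2 Q) : copies_km rl h2 k :=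
  (tlift (fun x a => [ffun i => (evaluation a i : K) *: x]) p.1, p.2).

Let ev_l (a : Q) :
  linear (fun x : kmp rl => [ffun i => (evaluation a i : K) *: x] : {ffun 'I_k -> kmp rl}).
Proof.
move=> c x y; apply/ffunP => i; rewrite !ffunE scalerDr.
by rewrite !scalerA (mulrC c).
Qed.

Let ev_r (x : kmp rl) :
  linear (fun a : Q => [ffun i => (evaluation a i : K) *: x] : {ffun 'I_k -> kmp rl}).
Proof.
have [el _ _ _] := evaluation_iso.
have lin (W : lmodType K) c (f f' : {ffun 'I_k -> W}) i : (c *: f + f') i = c *: f i + f' i.
  by rewrite !ffunE.
move=> c a b; apply/ffunP => i; rewrite el lin [LHS]ffunE lin.
rewrite [in RHS]ffunE [X in _ = _ + X]ffunE.
by rewrite scalerDl -scalerA.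
Qed.

Lemma split_copies_induced : induced_by evaluation split_copies.
Proof. by move=> x a y; rewrite /split_copies tlift_pure. Qed.

Lemma split_copies_iso : lie_iso split_copies.
Proof.
have [el e1 eM [einv evK invK]] := evaluation_iso.
split.
  apply: semidir_lift_hom => // [x y a b|z x a]; apply/ffunP => i.
    rewrite eM; move: (evaluation a) (evaluation b) => f1 f2.
    by rewrite !ffunE bracketZl bracketZr scalerA.
  by rewrite !ffunE (lfZ (der_linr _ _)).
pose d (i : 'I_k) : {ffun 'I_k -> K^o} := [ffun j => (i == j)%:R : K^o].
pose inv (q : copies_km rl h2 k) : ckm rl h2 Q :=
  (\sum_i q.1 i ⊗ einv (d i), q.2).
have tl := tlift_linear ev_l ev_r.
have evd i j : evaluation (einv (d i)) j = (i == j)%:R by rewrite invK ffunE.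
exists inv => [[t y]|[f y]]; congr pair.
  rewrite /inv /=.
  apply: (@tens_ext _ _ _ _
    (fun t => \sum_i (tlift _ t : {ffun 'I_k -> kmp rl}) i ⊗ einv (d i)) id) => //.
    move=> c s s'; rewrite tl scaler_sumr -big_split; apply: eq_bigr => i _ /=.
    by rewrite 2!ffunE tpure_linl.
  move=> x a; rewrite tlift_pure //.
  rewrite -[in RHS](evK a).
  transitivity (\sum_i x ⊗ ((evaluation a i : K) *: einv (d i))).
    apply: eq_bigr => i _; rewrite ffunE.
    by rewrite (lfZ (tpure_linl _)) (lfZ (tpure_linr _)).
  have tr : linear (tpure x : Q -> tens _ Q) by exact: tpure_linr.
  rewrite -(big_morph _ (lfD tr) (lf0 tr)); congr (_ ⊗ _).
  apply: (can_inj evK); rewrite evK; apply/ffunP => j.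
  rewrite (big_morph _ (lfD el) (lf0 el)) sum_ffunE (bigD1 j) //= big1 => [|i ij].
    by rewrite (lfZ el) ffunE evd eqxx addr0; exact: mulr1.
  by rewrite (lfZ el) ffunE evd (negPf ij); exact: mulr0.
rewrite /= (big_morph _ (lfD tl) (lf0 tl)); apply/ffunP => j.
rewrite sum_ffunE (bigD1 j) //= big1 => [|i ij].
  by rewrite tlift_pure // ffunE evd eqxx scale1r addr0.
by rewrite tlift_pure // ffunE evd (negPf ij) scale0r.
Qed.
End Evaluation.

(** * The ideal of an integrable highest weight module *)

Lemma common_kernel (K : closedFieldType) (A : comAlgType K) k
    (chi : 'I_k -> A -> K) : (0 < k)%N -> (forall i, is_char (chi i)) ->
  exists J : idealr A, forall a, a \in J <-> forall i, chi i a = 0.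
Proof.
move=> k0 chiP; pose S : {pred A} := [pred a | `[< forall i, chi i a = 0 >]].
have SP : idealr_closed S.
  split=> [||a b c /asboolP Hb /asboolP Hc].
  - by apply/asboolP => i; exact: char0.
  - apply/asboolP => /(_ (Ordinal k0)) /eqP.
    by rewrite char1 ?oner_eq0.
  by apply/asboolP => i; rewrite charD // charM // Hb Hc mulr0 addr0.
pose J := HB.pack_for (idealr A) S (isIdealr.Build A S SP).
by exists J => a; split=> /asboolP.
Qed.

Section VanishingIdeal.
Variables (K : numClosedFieldType) (n : nat) (C : 'M[int]_n) (C_gcm : gcm C).
Variables (h : vectType K) (rl : realization C h) (h2 : submodClosed h).
Hypothesis h2_compl : complement_hp rl h2.
Variables (A : comAlgType K) (psi : {linear cartan_cur rl h2 A -> K^o}).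
Variables (V : lmodType K) (act : lie_mod (ckm rl h2 A) V).
Hypothesis V_psi : is_Vpsi psi act.
Hypothesis V_int : integrable act.
Hypothesis V_fin : finite_weight_spaces act.

Lemma lowering_weight i a lam w : weight_space act lam w ->
  weight_space act (lam - Defs.root rl i) (act (ckm_g h2 (kmp_f C_gcm rl i) a) w).
Proof.
move=> Hw x y; rewrite -[(_, _)]/(cartan_elt (x, 1, y)) act_XF.
rewrite [act (cartan_elt _) w]Hw (lfZ (lact_linr act _)).
rewrite /cartan_wt /= -scalerDl -(linearD (Defs.root rl i)) -scalerAl mul1r.
by rewrite (lfZ (act_linear_coef act _ _)) -scalerBl add_lfunE opp_lfunE.
Qed.

(** A vector is a sum of weight vectors, and f_i ⊗ a maps the one of weight lam to
    the finite-dimensional weight space of lam - alpha_i, whatever [a] is. *)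
Lemma lowering_cofinite i w : exists T : finType,
  cofinite_by T (fun a : A => act (ckm_g h2 (kmp_f C_gcm rl i) a) w = 0).
Proof.
have [[wts _] _] := V_int; have [m [lam [u [Hu ->]]]] := wts w.
pose P (l : 'I_m) (a : A) := act (ckm_g h2 (kmp_f C_gcm rl i) a) (u l) = 0.
have lin l := act_linear_coef act (kmp_f C_gcm rl i) (u l).
have [||l|T HT] := @cofinite_all K A 'I_m P.
- by move=> l; exact: lf0 (lin l).
- by move=> l c x y Px Py; rewrite /P (lin l) Px Py scaler0 addr0.
- have [d [s [_ Hs]]] := V_fin (lam l - Defs.root rl i).
  exists 'I_d.+1; apply: cofinite_ker (lin l) _ => a.
  by apply/Hs/lowering_weight.
exists T; apply: cofinite_imp HT => a Pa.
rewrite (big_morph _ (lfD (lact_linr act _)) (lf0 (lact_linr act _))).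
by apply: big1 => l _; exact: Pa.
Qed.

Lemma vanishing_ideal_exists : exists I : A -> Prop, [/\ is_ideal I,
  forall b k, I (b ^+ k.+1) -> I b,
  exists T : finType, cofinite_by T I
  & forall a, I a -> forall x v, act (ckm_g h2 x a) v = 0].
Proof.
have [v v0 [Nv Hv]] := highest_weight_vector V_psi.
have [rho Hrho] := exists_rho rl.
have [dec _] := h2_compl; have [x0 [y0 [Hx Hy Erho]]] := dec rho.
pose D : cartan_index rl h2 A := (SubOf Hx, 1, SubOf Hy).
pose E i a := act (ckm_g h2 (kmp_e C_gcm rl i) a).
pose F i a := act (ckm_g h2 (kmp_f C_gcm rl i) a).
pose X (c : cartan_index rl h2 A) := act (cartan_elt c).
have EL i a : linear (E i a) by exact: lact_linr.
have FL i a : linear (F i a) by exact: lact_linr.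
have XL c : linear (X c) by exact: lact_linr.
have FLc i u : linear (F i ^~ u) by exact: act_linear_coef.
have XX c d u : X c (X d u) = X d (X c u).
  by rewrite /X act_commutator cartan_comm (lf0 (lact_linl act u)) addr0.
have XE c j b u : X c (E j b u) = E j b (X c u) + E j (cartan_wt c j * b) u.
  exact: act_XE.
have XF c j b u : X c (F j b u) = F j b (X c u) - F j (cartan_wt c j * b) u.
  exact: act_XF.
have EF i j a b u : E i a (F j b u) = F j b (E i a u) +
    (if i == j then X (coroot_index rl h2 i (a * b)) u else 0).
  exact: act_EF.
have wt_co i j (a : A) : cartan_wt (coroot_index rl h2 i a) j =
    (C i j)%:~R *: a := coroot_index_wt _ _ _ _ _.
have q_diag i : (C i i)%:~R = 2 :> K by have [-> _ _] := C_gcm.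
have wt_D j : cartan_wt D j = 1.
  rewrite /cartan_wt /= -scalerDl.
  have -> : (Defs.root rl j x0 : K) + Defs.root rl j y0 = 1.
    by rewrite -(Hrho j) Erho linearD.
  exact: scale1r.
have Ev i a : E i a v = 0.
  (* A positive root must have a nonzero root vector, whence the case e_i = 0. *)
  apply: Nv; have [e0|/eqP e0] := eqVneq (km_e rl i) 0; first by rewrite /= e0 rpred0.
  apply: mem_span; exists (Defs.root rl i); split; last by move=> y; exact: km_he.
  split; last by exists (km_e rl i); split=> // y; exact: km_he.
  exists (fun j => nat_of_bool (i == j)); split; first by exists i; rewrite eqxx.
  rewrite (bigD1 i) //= eqxx big1 ?addr0 // => j ji.
  by rewrite eq_sym (negPf ji).
have Xv c : exists k : K, X c v = k *: v.
  by case: c => [[x a] y]; exact: Hv.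
have irr (S : submodClosed V) : (forall i a u, u \in S -> E i a u \in S) ->
    (forall i a u, u \in S -> F i a u \in S) ->
    (forall c u, u \in S -> X c u \in S) ->
    (forall u, u \in S -> u = 0) \/ (forall u, u \in S).
  move=> SE SF SX; have [[_ irr] _] := V_psi; apply: irr.
  exact: act_from_generators SE SF SX.
have [d0 Dv] := Xv D.
have nil i a u : exists k, iter k (F i a) u = 0.
  have [_ Hint] := V_int.
  (* -alpha_i is the reflection of alpha_i in itself. *)
  have rr : real_root rl (Defs.root rl i - (Defs.root rl i (coroot rl i) : K) *: Defs.root rl i).
    by constructor; constructor.
  have [|k [_ Hk]] := Hint _ (kmp_f C_gcm rl i) rr _ a u; last by exists k.
  move=> y; rewrite [val _]/= km_hf add_lfunE opp_lfunE scale_lfunE root_coroot_diag //.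
  congr (_ *: _); rewrite -[_ *: _]/(2 * (Defs.root rl i y : K)); ring.
pose I : A -> Prop := vanishing F v.
have [idI radI I0] := vanishing_spec EL FL XL FLc XX XE XF EF wt_co q_diag
  wt_D v0 Ev Xv irr Dv nil.
exists I; split=> // [|a Ia x u].
- apply: (cofinite_all (P := fun i a => F i a v = 0)) => [i|i c a b Pa Pb|i].
  + exact: (lf0 (FLc i v)).
  + by rewrite FLc Pa Pb scaler0 addr0.
  exact: lowering_cofinite.
exact: (kmp_acts0 (act := act) (I := I)) Ia.
Qed.
End VanishingIdeal.

Theorem theorem3p3 (R : realType)
  (n : nat) (C : 'M[int]_n) (C_gcm : gcm C)
  (h : vectType R[i]) (rl : realization C h)
  (h2 : submodClosed h) (h2_compl : complement_hp rl h2)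
  (A : comAlgType R[i]) (A_fg : finitely_generated A)
  (psi : {linear cartan_cur rl h2 A -> (R[i])^o})
  (V : lmodType R[i]) (act : lie_mod (ckm rl h2 A) V)
  (V_psi : is_Vpsi psi act)
  (V_int : integrable act) (V_fin : finite_weight_spaces act) :
  exists J : idealr A,
    [/\ radical_ideal J,
        forall (x : kmp rl) (a : A) (v : V),
          a \in J -> act (ckm_g h2 x a) v = 0,
        exists W : lie_mod (ckm rl h2 {ideal_quot J}) V,
          forall p v, act p v = W (ckm_proj J p) v
      & exists (k : nat) (phi : {ideal_quot J} -> {ffun 'I_k -> (R[i])^o})
            (theta : ckm rl h2 {ideal_quot J} -> copies_km rl h2 k),
          [/\ (0 < k)%N, alg_iso phi, lie_iso theta, induced_by phi theta
            & exists W : lie_mod (copies_km rl h2 k) V,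
                forall p v, act p v = W (theta (ckm_proj J p)) v]].
Proof.
have [I [idI radI [T HT] I0]] := vanishing_ideal_exists C_gcm h2_compl V_psi V_int V_fin.
have [k [chi [k0 chiP dist kerI]]] : exists k (chi : 'I_k -> A -> R[i]),
    [/\ (0 < k)%N, forall i, is_char (chi i),
      forall i j, i != j -> exists a, chi i a <> chi j a
      & forall a, (forall i, chi i a = 0) -> I a].
  have [I1|nI1] := pselect (I 1).
    (* Here g' ⊗ A acts as zero and any character of A will do. *)
    have [chi chiP] := weak_nullstellensatz (@complex_pigeonhole R) A_fg.
    exists 1%N, (fun=> chi); split=> // [i j|a _]; first by rewrite !ord1.
    by have [_ _ IM] := idI; rewrite -[a]mulr1; exact: IM.
  have [k [chi [chiP dist kerI]]] := radical_family idI radI HT.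
  exists k, chi; split=> //; case: k chi chiP dist kerI => // chi _ _ kerI.
  by case: nI1; apply: kerI => -[].
have [J HJ] := common_kernel k0 chiP.
have J0 x a v : a \in J -> act (ckm_g h2 x a) v = 0.
  by move/HJ/kerI => Ia; exact: I0.
have [w Hw] := act_factors_proj J0.
have proj_hom := @ckm_proj_hom _ _ _ _ rl h2 _ J.
exists J; split=> //.
- move=> a; split=> [[m [m0 /HJ am]]|Ja]; last by exists 1%N.
  apply/HJ => i; apply/eqP; have := am i; rewrite charX // => /eqP.
  by rewrite expf_eq0 m0.
- exact: lie_mod_factor proj_hom (@ckm_proj_surj _ _ _ _ _ _ _ _) Hw.
have [[tl tB] [inv tK invK]] := split_copies_iso rl h2 chiP dist HJ.
exists k, (evaluation (J := J) chi), (split_copies (rl := rl) (h2 := h2) (J := J) chi); split=> //.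
- exact: evaluation_iso.
- exact: split_copies_iso.
- exact: split_copies_induced.
apply: (lie_mod_factor (f := fun p => split_copies chi (ckm_proj J p))
  (w := fun q => w (inv q))).
- have [pl pB] := proj_hom; split=> [c p q|p q]; first by rewrite pl tl.
  by rewrite pB tB.
- by move=> q; have [p Hp] := ckm_proj_surj (J := J) (inv q); exists p; rewrite Hp invK.
by move=> p v; rewrite tK.
Qed.
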